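(* Let $c>0$ and, for a given sequence of particle configurations $(X_i,\xi_i)_{1\le i\le N}$ in $\mathbb R^3\times\mathbb S^2$ satisfying $|X_i-X_j|\ge cN^{-1/3}$ for all $i\ne j$, let $\eta>0$ satisfy $\eta\le\frac c4N^{-1/3}$. Then, for any $\Psi_1,\Psi_2\in C(\mathbb R^3\times\mathbb S^2;\mathbb R^{3\times3}_0)$, $$\frac1{N^2}\sum_i\sum_{j\ne i}\Psi_1(X_i,\xi_i):\big(\nabla^2G(X_i-X_j)\Psi_2(X_j,\xi_j)\big)=-\int_{\mathbb R^3}\nabla h^{N,\eta}[\Psi_1]:\nabla h^{N,\eta}[\Psi_2]\,dx+\sum_i\int_{\mathbb R^3}\nabla h_i^{N,\eta}[\Psi_1]:\nabla h_i^{N,\eta}[\Psi_2]\,dx.$$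
   Context: $\mathbb R^{3\times3}_0$ denotes trace-free real $3\times3$ matrices. The Oseen tensor is $G(x)=\frac1{8\pi}\big(\frac{\mathrm{Id}}{|x|}+\frac{x\otimes x}{|x|^3}\big)$, with $P(x)=\frac1{4\pi}\frac x{|x|^3}$, solving $-\Delta G+\nabla P=\delta_0\mathrm{Id}$, $\mathrm{div}\,G=0$. For a matrix $A$, $(\nabla^2G\,A)_{ij}=\partial_j\partial_lG_{ik}A_{kl}$ (summation convention). For $A\in\mathbb R^{3\times3}_0$, set $h[A]=(A_{lm}\partial_mG_{kl})_{1\le k\le3}$ and $p[A]=A_{lm}\partial_mP_l$, so that $-\Delta h[A]+\nabla p[A]=(A\nabla)\delta_0$, $\mathrm{div}\,h[A]=0$ in $\mathbb R^3$, where $((A\nabla)\delta_0)_l=A_{lm}\partial_m\delta_0$. For $\eta>0$ define the regularization $h^\eta[A]$ by: $h^\eta[A]=h[A]$, $p^\eta[A]=p[A]$ in $\mathbb R^3\setminus B(0,\eta)$; $-\Delta h^\eta[A]+\nabla p^\eta[A]=0$, $\mathrm{div}\,h^\eta[A]=0$ in $B(0,\eta)$, with $h^\eta[A]$ continuous across $\partial B(0,\eta)$ (i.e. its interior trace equals $h[A]$ on $\partial B(0,\eta)$). For $\Psi\in C(\mathbb R^3\times\mathbb S^2;\mathbb R^{3\times3}_0)$ set $h_i^{N,\eta}[\Psi](x)=\frac1Nh^\eta[\Psi(X_i,\xi_i)](x-X_i)$ and $h^{N,\eta}[\Psi]=\sum_{i=1}^Nh_i^{N,\eta}[\Psi]$.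 *)

(* Defs.v *)
From mathcomp Require Import all_boot all_order all_algebra.
From mathcomp Require Import all_classical all_reals all_analysis.

Set Implicit Arguments.
Unset Strict Implicit.
Unset Printing Implicit Defensive.
Import Order.TTheory GRing.Theory Num.Theory.
Import numFieldNormedType.Exports.

Local Open Scope classical_set_scope.
Local Open Scope ring_scope.

Section Stokes.
Context {R : realType}.

Notation vec := 'rV[R]_3.
Notation mat := 'M[R]_3.

(* The norm `|x| of the library on 'rV[R]_3 is the sup norm, hence this
   definition; both norms induce the same topology. *)
Definition enorm (x : vec) : R := Num.sqrt (\sum_i x 0 i ^+ 2).

Definition eball (r : R) : set vec := [set x | enorm x < r].

Definition sphere2 : set vec := [set x | enorm x = 1].

Definition ddot (A B : mat) : R := \sum_i \sum_j A i j * B i j.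

Definition pd (m : 'I_3) (f : vec -> R) : vec -> R := 'D_('e_m) f.

Definition grad (u : vec -> vec) (x : vec) : mat :=
  \matrix_(k, m) pd m (fun y => u y 0 k) x.

Definition div (u : vec -> vec) (x : vec) : R :=
  \sum_k pd k (fun y => u y 0 k) x.

Definition laplacian (f : vec -> R) (x : vec) : R := \sum_m pd m (pd m f) x.

(* f belongs to C^k of the closure of U, for U open: f is C^k in U and all its
   partial derivatives of order at most k extend continuously to the closure. *)
Fixpoint Ck_closure (k : nat) (U : set vec) (f : vec -> R) : Prop :=
  (exists g : vec -> R, {within closure U, continuous g} /\
                        (forall x, U x -> g x = f x)) /\
  if k is k'.+1 then
    forall m : 'I_3, (forall x, U x -> derivable f x 'e_m) /\
                     Ck_closure k' U (pd m f)
  else True.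

Definition oseen (x : vec) : mat :=
  (8 * pi)^-1 *: ((enorm x)^-1 *: 1%:M + (enorm x ^+ 3)^-1 *: (x^T *m x)).

Definition oseen_pressure (x : vec) : vec :=
  (4 * pi)^-1 *: ((enorm x ^+ 3)^-1 *: x).

Definition hess_oseen (x : vec) (A : mat) : mat :=
  \matrix_(i, j) \sum_k \sum_l pd j (pd l (fun y => oseen y i k)) x * A k l.

Definition dipole (A : mat) (x : vec) : vec :=
  \row_k \sum_l \sum_m A l m * pd m (fun y => oseen y k l) x.

Definition dipole_pressure (A : mat) (x : vec) : R :=
  \sum_l \sum_m A l m * pd m (fun y => oseen_pressure y 0 l) x.

(* Continuity of u on the whole space encodes the boundary condition: u equals
   dipole A on the sphere |x| = eta, so its interior trace is dipole A there.
   The boundary data being smooth, the interior Stokes solution is smooth up to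
   the boundary; the two Ck_closure clauses fix that solution class, in which u
   is unique. *)
Definition is_regularization (eta : R) (A : mat)
    (u : vec -> vec) (p : vec -> R) : Prop :=
  [/\ forall x, eta <= enorm x -> u x = dipole A x /\ p x = dipole_pressure A x,
      continuous u,
      forall k : 'I_3, Ck_closure 2 (eball eta) (fun x => u x 0 k),
      Ck_closure 1 (eball eta) p
    & forall x, eball eta x ->
        (forall k : 'I_3, - laplacian (fun y => u y 0 k) x + pd k p x = 0) /\
        div u x = 0].

Definition reg_dipole (eta : R) (A : mat) : vec -> vec :=
  get [set u : vec -> vec | exists p, is_regularization eta A u p].

(* Psi is continuous on R^3 x S^2 with trace-free values; its values off
   R^3 x S^2 are irrelevant. *)
Definition continuous_tracefree (Psi : vec * vec -> mat) : Prop :=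
  {within [set z | sphere2 z.2], continuous Psi} /\
  (forall z, sphere2 z.2 -> \tr (Psi z) = 0).

Definition hpart N (X xi : 'I_N -> vec) (eta : R) (Psi : vec * vec -> mat)
    (i : 'I_N) (x : vec) : vec :=
  N%:R^-1 *: reg_dipole eta (Psi (X i, xi i)) (x - X i).

Definition htotal N (X xi : 'I_N -> vec) (eta : R) (Psi : vec * vec -> mat)
    (x : vec) : vec :=
  \sum_i hpart X xi eta Psi i x.

Definition vec3 (a b c : R) : vec := \row_(i < 3) [:: a; b; c]`_i.

(* Values in \bar R: an identity between such integrals and a real number
   forces them to be finite. *)
Definition integral3 (f : vec -> R) : \bar R :=
  let mu := @lebesgue_measure R in
  (\int[(mu \x mu) \x mu]_z (f (vec3 z.1.1 z.1.2 z.2))%:E)%E.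

End Stokes.

(* Main.v *)
From HB Require Import structures.
Require Import Defs.
From mathcomp Require Import all_boot all_order all_algebra.
From mathcomp Require Import all_classical all_reals all_analysis.
From mathcomp Require Import measurable_realfun ring lra.
Set Implicit Arguments.
Unset Strict Implicit.
Unset Printing Implicit Defensive.
Import Order.TTheory GRing.Theory Num.Theory.
Import numFieldNormedType.Exports.
Local Open Scope classical_set_scope.
Local Open Scope ring_scope.

(* Fix i <> j and let u, v be the regularized dipole fields of strengths A, B
   centred at X_i, X_j. For e <= eta the exact dipole field at X_i has, besides
   its Stokes extension to the ball, an explicit C^2 extension u_e into B(X_i, e),
   which solves - Delta u_e + grad p_e = (A grad) f_e with a blob f_e of mass one
   supported in B(X_i, e).
   The field u - u_e is continuous, divergence free and vanishes outside
   B(X_i, eta), and there grad v is, up to a pressure, the divergence-free stress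
   of such an extension of the dipole at X_j; hence u may be replaced by u_e in
   the integral of grad u : grad v. Testing the equation of u_e with v then gives
     int grad u : grad v = - int f_e (A : grad v),
   which tends to - A : grad v (X_i) = - A : (nabla^2 G (X_i - X_j) B) as e -> 0.
   Expanding the integral of the totals leaves these cross terms and the diagonal.

   All gradients jump across spheres, so a field is handled through its cut
   outside a finite list of spheres (a null set), and integration by parts is the
   fundamental theorem of calculus on each coordinate line, which meets the
   spheres in finitely many points. *)

(** The stress of a regularized field jumps across its own sphere, so testing its momentum equation
    on the whole space would leave surface terms. The smooth extensions avoid this. Away from 0 one
    has [8 pi G = Delta |x| Id - nabla^2 |x|]; replacing [|x|] by [phi] keeps the divergence zero
    and turns the Dirac mass into [- Delta^2 phi / (8 pi)]. With [phi] a Taylor polynomial near the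
    centre, the velocity is C^1 across the sphere and the stress, blob included, is continuous; only
    its derivatives jump. In the replacement step [grad (u - u_e)] vanishes outside the ball at
    [X_i], and the smooth stress at [X_j] differs from the true one only in the ball at [X_j];
    separation of the balls keeps the two apart. Pressures drop out because they meet gradients of
    trace zero. Velocities decay with order 2, gradients and pressures with order 3, second
    derivatives with order 4, so every product that is integrated has order 6. Since
    [(1 + |x|^2)^-3] lies below a product of functions [1 / (1 + t^2)], one bound gives
    integrability on the space and on every coordinate line. The blob changes sign: its
    concentration needs, besides its mass, an L^1 bound uniform in [e]. *)

Section line_integrals.

(** * One-variable calculus with finitely many exceptional points *)

Context {R : realType}.
Notation mu := (@lebesgue_measure R).

(** The derivative is known only inside the interval, so [F] is compared with the integral function
    [G]: [G - F] is continuous up to the endpoints and has zero derivative inside, and the mean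
    value theorem makes its increment zero. *)
Lemma ftc_open (f F : R -> R) (a b : R) : a <= b ->
  continuous F ->
  (forall t, a < t < b -> is_derive t 1 F (f t) /\ {for t, continuous f}) ->
  mu.-integrable `[a, b] (EFin \o f) ->
  (\int[mu]_(t in `[a, b]) f t)%R = F b - F a.
Proof.
rewrite le_eqVlt => /predU1P[<- *|ab cF dF intf].
  by rewrite set_itv1 Rintegral_set1 subrr.
pose G x := (\int[mu]_(t in `[a, x]) f t)%R.
have cG := parameterized_integral_continuous (ltW ab) intf.
have dG x : x \in `]a, b[%R -> is_derive x 1 (G - F) 0.
  rewrite in_itv/= => /andP[ax xb].
  have /dF[dFx cf] : a < x < b by rewrite ax xb.
  have [dGx GE] := continuous_FTC1_closed xb intf ax cf.
  have dG : is_derive x 1 G (f x) by apply: (DeriveDef dGx); exact: etrans (esym (derive1E _ _)) GE.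
  by have := is_deriveB dG dFx; rewrite subrr.
have cGF : {within `[a, b], continuous (G - F)}.
  move=> x; apply: (@continuousB _ _ (subspace `[a, b])); first exact: cG.
  exact/continuous_subspaceT.
have [c _] := MVT_segment (ltW ab) dG cGF.
rewrite mul0r => /eqP; rewrite subr_eq0 => /eqP.
rewrite /GRing.opp /GRing.add /= /G set_itv1 Rintegral_set1 sub0r => /eqP.
by rewrite subr_eq addrC => /eqP.
Qed.

(** Induction on the exceptional points: one that lies strictly between [a] and [b] splits the
    interval, and since [F] is continuous there the two increments add up. *)
Lemma ftc_finite (ts : seq R) (f F : R -> R) (a b : R) : a <= b ->
  continuous F ->
  (forall t, a < t < b -> t \notin ts ->
     is_derive t 1 F (f t) /\ {for t, continuous f}) ->
  mu.-integrable `[a, b] (EFin \o f) ->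
  (\int[mu]_(t in `[a, b]) f t)%R = F b - F a.
Proof.
elim: ts a b => [|c ts IH] a b ab cF dF intf.
  by apply: ftc_open => // t tab; exact: dF.
have [/andP[ac cb]|cab] := boolP (a < c < b); last first.
  apply: IH => // t tab tts; apply: dF => //; rewrite inE negb_or tts andbT.
  by apply: contraNneq cab => <-.
have intfl : mu.-integrable `[a, c] (EFin \o f).
  by apply: integrableS intf => //; apply: subset_itvl; rewrite bnd_simp ltW.
have intfr : mu.-integrable `[c, b] (EFin \o f).
  by apply: integrableS intf => //; apply: subset_itvr; rewrite bnd_simp ltW.
have := @Rintegral_itvB _ f (BLeft a) (BRight b) c.
rewrite !bnd_simp => /(_ intf (ltW ac) (ltW cb)) => E.
have -> : (\int[mu]_(t in `[a, b]) f t)%R =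
    (\int[mu]_(t in `[a, c]) f t)%R + (\int[mu]_(t in `[c, b]) f t)%R.
  rewrite -(Rintegral_itv_obnd_cbnd (r := c)).
    by rewrite -E addrC subrK.
  by apply: integrableS intfr => //; exact: subset_itv_oc_cc.
have -> : F b - F a = (F c - F a) + (F b - F c) by rewrite [RHS]addrC subrKA.
congr (_ + _).
  apply: IH => //; first exact: ltW.
  move=> t /andP[h1 h2] tts; apply: dF; first by rewrite h1 (lt_trans h2).
  by rewrite inE negb_or tts andbT; apply: contraTneq h2 => ->; rewrite ltxx.
apply: IH => //; first exact: ltW.
move=> t /andP[h1 h2] tts; apply: dF; first by rewrite h2 (lt_trans ac).
by rewrite inE negb_or tts andbT; apply: contraTneq h1 => ->; rewrite ltxx.
Qed.

(** The integral over [[-n, n]] is [F n - F (- n)], which tends to 0; dominated convergence, with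
    [|f|] as majorant, identifies the limit with the full integral. *)
Lemma integral_derive_line (ts : seq R) (f F : R -> R) :
  continuous F ->
  (forall t, t \notin ts -> is_derive t 1 F (f t) /\ {for t, continuous f}) ->
  mu.-integrable setT (EFin \o f) ->
  F t @[t --> +oo] --> 0 -> F t @[t --> -oo] --> 0 ->
  (\int[mu]_t (f t)%:E = 0)%E.
Proof.
move=> cF dF intf Fy FNy.
pose I n := `[- n%:R : R, n%:R]%classic.
have intn n : mu.-integrable (I n) (EFin \o f).
  by apply: integrableS intf => //; exact: measurable_itv.
have En n : (\int[mu]_(t in I n) (f t)%:E)%E
    = (F n%:R - F (- n%:R))%:E.
  rewrite -(@ftc_finite ts f)//.
  - rewrite /Rintegral fineK//; apply: integrable_fin_num => //.
    exact: intn.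
  - by rewrite (@le_trans _ _ 0)// oppr_le0.
  - by move=> t _; exact: dF.
  - exact: intn.
pose fn n := ((EFin \o f) \_ (I n))%E.
have fnf : (\int[mu]_t fn n t)%E @[n --> \oo] --> (\int[mu]_t (f t)%:E)%E.
  have mf := measurable_int _ intf.
  apply: (@dominated_cvg _ _ _ mu setT measurableT fn _ (abse \o (EFin \o f))).
  - move=> n; apply: measurable_int; apply/(integrable_mkcond _ _).1.
      exact: measurable_itv.
    exact: intn.
  - move=> t _; apply: cvg_near_cst; near=> n.
    rewrite /fn patchE ifT// inE /I /= in_itv/= -ler_norml.
    by near: n; exact: nbhs_infty_ger.
  - by move=> t _ /=.
  - exact: integrable_abse.
  - by move=> n t _; rewrite /fn patchE; case: ifP => // _; rewrite abse0 abse_ge0.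
have fn0 : (\int[mu]_t fn n t)%E @[n --> \oo] --> 0%:E.
  under eq_fun do rewrite /fn -integral_mkcond En.
  apply: cvg_EFin; first exact: nearW.
  rewrite -[X in _ --> X](subrr 0); apply: cvgB.
    exact: cvg_comp (@cvgr_idn R) Fy.
  apply: (cvg_comp _ _ _ FNy).
  by apply/cvgNry; rewrite opprK; exact: cvgr_idn.
exact: cvg_unique fnf fn0.
Unshelve. all: by end_near. Qed.

End line_integrals.

Definition o0 : 'I_3 := @Ordinal 3 0 isT.
Definition o1 : 'I_3 := @Ordinal 3 1 isT.
Definition o2 : 'I_3 := @Ordinal 3 2 isT.

Lemma ord3_ind (P : 'I_3 -> Prop) : P o0 -> P o1 -> P o2 -> forall k, P k.
Proof.
by move=> h0 h1 h2 [[|[|[|//]]] hk];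
  [move: h0|move: h1|move: h2]; congr P; exact: val_inj.
Qed.

Lemma sum3E (V : nmodType) (f : 'I_3 -> V) : \sum_i f i = f o0 + f o1 + f o2.
Proof.
rewrite 3!big_ord_recr big_ord0/= add0r.
by congr (f _ + f _ + f _); exact: val_inj.
Qed.

(** * Lebesgue measure on the triple product and an integrable majorant *)

Section space.
Context {R : realType}.
Notation vec := 'rV[R]_3.
Notation mu := (@lebesgue_measure R).
Notation TR := (measurableTypeR R).

(** Squares of an exhausting sequence. The triple product is [(mu \x mu) \x mu], and Fubini's
    theorem for it asks that its first factor be sigma-finite. *)
Lemma sigma_finite_leb2 : sigma_finite setT (mu \x mu)%E.
Proof.
have /sigma_finiteP[F [TF ndF Foo]] := sigma_finiteT mu.
exists (fun n => F n `*` F n).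
  rewrite -setXTT TF predeqE => -[x y]; split.
    move=> [/= [n _ Fnx] [k _ Fky]]; exists (maxn n k) => //; split.
    - by move: x Fnx; exact/subsetPset/ndF/leq_maxl.
    - by move: y Fky; exact/subsetPset/ndF/leq_maxr.
  by move=> [n _ []/= ? ?]; split; exists n.
move=> k; have [? ?] := Foo k; split; first exact: measurableX.
by rewrite product_measure1E// lte_mul_pinfty// ge0_fin_numE.
Qed.

Definition leb2 : {sigma_finite_measure set (TR * TR)%type -> \bar R} :=
  HB.pack (mu \x mu)%E (Measure_isSigmaFinite.Build _ _ _ (mu \x mu)%E sigma_finite_leb2).

Definition leb3 : {measure set (TR * TR * TR)%type -> \bar R} := (leb2 \x mu)%E.

Definition sqn (x : vec) : R := \sum_i x 0 i ^+ 2.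

Definition V3 (z : (TR * TR * TR)%type) : vec := vec3 z.1.1 z.1.2 z.2.

Lemma V3E z k : V3 z 0 k = [:: z.1.1; z.1.2; z.2]`_k.
Proof. by rewrite mxE. Qed.

(** Openness refers to the norm of row vectors, measurability to products of measurable sets of
    reals; the link is that an open set is the countable union of the rational cubes it contains. *)
Lemma open_preimage_measurable (U : set vec) : open U -> measurable (V3 @^-1` U).
Proof.
move=> oU.
pose cell (a b c : rat) (n : nat) : set (TR * TR * TR) :=
  ((ball (ratr a : R) n.+1%:R^-1) `*` (ball (ratr b : R) n.+1%:R^-1))
     `*` (ball (ratr c : R) n.+1%:R^-1).
pose cell' a b c n : set (TR * TR * TR) :=
  if `[< cell a b c n `<=` V3 @^-1` U >] then cell a b c n else set0.
have -> : V3 @^-1` U = \bigcup_a \bigcup_b \bigcup_c \bigcup_n cell' a b c n.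
  rewrite eqEsubset; split; last first.
    move=> z [a _ [b _ [c _ [n _]]]]; rewrite /cell'.
    by case: asboolP => // + ?; exact.
  move=> z Uz.
  have /nbhs_ballP[e /= e0 eU] : nbhs (V3 z) U by exact: open_nbhs_nbhs.
  (* Two points of one cell may be twice its radius apart in each coordinate. *)
  have [n ne] : exists n, n.+1%:R^-1 < e / 2 :> R.
    have e2 : 0 < e / 2 by rewrite divr_gt0.
    exists (Num.truncn (e / 2)^-1).
    rewrite -[ltRHS]invrK ltf_pV2 ?posrE ?invr_gt0//.
    exact: truncnS_gt.
  have rat_near (t r : R) : 0 < r -> exists q : rat, ball (ratr q : R) r t.
    move=> r0; have /rat_in_itvoo[q] : t - r < t + r by lra.
    rewrite in_itv/= => /andP[q1 q2]; exists q.
    by rewrite /ball/= ltr_norml; apply/andP; split; lra.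
  have n0 : 0 < n.+1%:R^-1 :> R by rewrite invr_gt0.
  have [a ha] := rat_near z.1.1 _ n0; have [b hb] := rat_near z.1.2 _ n0.
  have [c hc] := rat_near z.2 _ n0.
  exists a => //; exists b => //; exists c => //; exists n => //.
  rewrite /cell'; case: asboolP => // h; exfalso; apply: h => y [[/= ya yb] yc].
  apply: eU; split=> // i j; rewrite ord1; clear i.
  have near2 (q : rat) s t : ball (ratr q : R) n.+1%:R^-1 s ->
      ball (ratr q : R) n.+1%:R^-1 t -> ball s e t.
    move: n.+1%:R^-1 ne => r re; rewrite /ball/= !ltr_norml.
    by move=> /andP[? ?] /andP[? ?]; apply/andP; split; lra.
  by elim/ord3_ind: j; rewrite !V3E /=; [exact: near2 ha ya|exact: near2 hb yb
    |exact: near2 hc yc].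
apply: bigcupT_measurable_rat => a.
apply: bigcupT_measurable_rat => b.
apply: bigcupT_measurable_rat => c.
apply: bigcupT_measurable => n; rewrite /cell'; case: asboolP => // _.
by do 2?apply: measurableX; rewrite ball_itv; exact: measurable_itv.
Qed.

Lemma open_continuous_measurable (U : set vec) (f : vec -> R) : open U ->
  (forall x, U x -> {for x, continuous f}) ->
  measurable_fun (V3 @^-1` U) (f \o V3).
Proof.
move=> oU cf; apply: (measurability _ (RGenOpens.measurableE R)).
move=> _ [_ [a [b ->] <-]].
rewrite (_ : _ `&` _ = V3 @^-1` (U `&` f @^-1` `]a, b[))//.
apply: open_preimage_measurable.
rewrite openE => x [Ux /= fx]; rewrite /interior; apply: filterI.
  exact: open_nbhs_nbhs.
apply: cf => //; apply: open_nbhs_nbhs; split => //.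
Qed.

Lemma integral_prod_sep d1 d2 (T1 : measurableType d1) (T2 : measurableType d2)
    (m1 : {sigma_finite_measure set T1 -> \bar R})
    (m2 : {sigma_finite_measure set T2 -> \bar R}) (f : T1 -> R) (g : T2 -> R) :
  measurable_fun setT f -> measurable_fun setT g ->
  (forall x, 0 <= f x) -> (forall y, 0 <= g y) ->
  (\int[m1 \x m2]_z (f z.1 * g z.2)%:E =
   \int[m1]_x (f x)%:E * \int[m2]_y (g y)%:E)%E.
Proof.
move=> mf mg f0 g0.
rewrite fubini_tonelli1 /fubini_F/=; first last.
- by move=> z; rewrite lee_fin mulr_ge0.
- apply/measurable_EFinP; apply: measurable_funM; exact: measurableT_comp.
transitivity (\int[m1]_x (\int[m2]_y (g y)%:E * (f x)%:E))%E.
  apply: eq_integral => x _ /=.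
  under eq_integral do rewrite EFinM.
  rewrite ge0_integralZl ?lee_fin// 1?muleC//.
  - exact/measurable_EFinP.
  - by move=> y _; rewrite lee_fin.
rewrite ge0_integralZl 1?muleC//.
- exact/measurable_EFinP.
- by move=> y _; rewrite lee_fin.
- by apply: integral_ge0 => y _; rewrite lee_fin.
Qed.

(** Majorant of all integrands of decay order 6. Its product form gives total integral [pi ^ 3] and
    also bounds its restrictions to planes and lines. *)
Definition omega (x : vec) : R := \prod_i (1 + x 0 i ^+ 2)^-1.

Lemma omega_V3 z :
  omega (V3 z) = (1 + z.1.1 ^+ 2)^-1 * (1 + z.1.2 ^+ 2)^-1 * (1 + z.2 ^+ 2)^-1.
Proof.
rewrite /omega 3!big_ord_recr big_ord0/= mul1r.
by rewrite !V3E.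
Qed.

Lemma oneDsqr_inv_ge0 (t : R) : 0 <= (1 + t ^+ 2)^-1.
Proof. by rewrite invr_ge0 addr_ge0// sqr_ge0. Qed.

Lemma oneDsqr_inv_le1 (t : R) : (1 + t ^+ 2)^-1 <= 1.
Proof. by rewrite invf_le1 ?lerDl ?sqr_ge0// ltr_wpDr// sqr_ge0. Qed.

Lemma measurable_oneDsqr_inv : measurable_fun setT (fun t : TR => (1 + t ^+ 2)^-1).
Proof. apply: continuous_measurable_fun; exact: continuous_oneDsqrV. Qed.

Lemma integral_oneDsqr_inv : (\int[mu]_t ((1 + t ^+ 2)^-1)%:E = (pi : R)%:E)%E.
Proof.
rewrite ge0_symfun_integralT.
- rewrite -set_itvcy integral0y_oneDsqr -EFinM; congr EFin; by field.
- exact: oneDsqr_inv_ge0.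
- exact: continuous_oneDsqrV.
- by move=> t /=; rewrite sqrrN.
Qed.

Lemma integrable_oneDsqr_inv (C : R) :
  mu.-integrable setT (fun t => (C * (1 + t ^+ 2)^-1)%:E).
Proof.
under eq_fun do rewrite EFinM.
apply: integrableZl => //; apply/integrableP; split.
  by apply/measurable_EFinP; exact: measurable_oneDsqr_inv.
under eq_integral do rewrite gee0_abs ?lee_fin ?oneDsqr_inv_ge0//.
by rewrite integral_oneDsqr_inv ltry.
Qed.

Lemma measurable_omega : measurable_fun setT (omega \o V3).
Proof.
apply: (eq_measurable_fun (fun z : TR * TR * TR =>
  (1 + z.1.1 ^+ 2)^-1 * (1 + z.1.2 ^+ 2)^-1 * (1 + z.2 ^+ 2)^-1)).
  by move=> z _; rewrite /= omega_V3.
have mw := measurable_oneDsqr_inv.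
do 2?[apply: measurable_funM]; apply: (measurableT_comp mw).
- exact: measurableT_comp.
- exact: measurableT_comp.
- exact: measurable_snd.
Qed.

Lemma omega_ge0 x : 0 <= omega x.
Proof. by apply: prodr_ge0 => i _; exact: oneDsqr_inv_ge0. Qed.

Lemma integrable_omega (C : R) : leb3.-integrable setT (fun z => (C * omega (V3 z))%:E).
Proof.
under eq_fun do rewrite EFinM.
apply: integrableZl => //; apply/integrableP; split.
  by apply/measurable_EFinP; exact: measurable_omega.
under eq_integral do rewrite gee0_abs ?lee_fin ?omega_ge0// omega_V3.
have mw := measurable_oneDsqr_inv.
have w0 := @oneDsqr_inv_ge0.
have mw2 : measurable_fun setT
    (fun p : TR * TR => (1 + p.1 ^+ 2)^-1 * (1 + p.2 ^+ 2)^-1).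
  by apply: measurable_funM; apply: (measurableT_comp mw).
have w2 p : 0 <= (1 + p.1 ^+ 2)^-1 * (1 + p.2 ^+ 2)^-1 :> R by rewrite mulr_ge0.
have := @integral_prod_sep _ _ _ _ leb2 mu _ _ mw2 mw w2 w0.
rewrite /= => ->; have := @integral_prod_sep _ _ _ _ mu mu _ _ mw mw w0 w0.
by rewrite /= => ->; rewrite integral_oneDsqr_inv -!EFinM ltry.
Qed.

End space.

(** * Changing an integrand on a null set *)

Section null_sets.
Import HBNNSimple.
Context d (T : measurableType d) (R : realType).
Variables (mu : {measure set T -> \bar R}) (N : set T).
Hypotheses (mN : measurable N) (muN : mu N = 0%E).
Local Open Scope ereal_scope.

(* The integral of a possibly non-measurable [f] is a supremum over simple
   functions. *)
Lemma ge0_integral_eq_off_null (f g : T -> \bar R) :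
  measurable_fun setT g -> (forall x, 0 <= g x) -> (forall x, g x <= f x) ->
  (forall x, ~ N x -> f x = g x) -> \int[mu]_x f x = \int[mu]_x g x.
Proof.
move=> mg g0 gf fg.
have f0 x : 0 <= f x by exact: le_trans (gf x).
apply/eqP; rewrite eq_le; apply/andP; split; last first.
  rewrite !ge0_integralTE//; apply: le_ereal_sup.
  move=> _ [h hg <-]; exists h => // x; exact: le_trans (gf x).
rewrite [leLHS]ge0_integralTE//; apply: ge_ereal_sup.
move=> _ [h hf <-]; rewrite -integralT_nnsfun.
rewrite (@ge0_negligible_integral _ _ _ _ setT N)//=.
- rewrite [leRHS](@ge0_negligible_integral _ _ _ _ setT N)//=.
  apply: ge0_le_integral => //.
  + by apply: measurableD.
  + by move=> x _; rewrite lee_fin fun_ge0.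
  + by apply/measurable_EFinP; exact: measurable_funTS.
  + exact: measurable_funTS.
  + by move=> x [_ Nx]; rewrite -fg.
- by apply/measurable_EFinP.
- by move=> x _; rewrite lee_fin fun_ge0.
Qed.

(** As [g] vanishes on [N], its positive and negative parts lie below those of [f] everywhere, which
    is what the nonnegative case asks; the values of [f] on [N] may then be arbitrary. *)
Lemma integral_eq_off_null (f g : T -> R) :
  measurable_fun setT g -> (forall x, N x -> g x = 0%R) ->
  (forall x, ~ N x -> f x = g x) ->
  \int[mu]_x (f x)%:E = \int[mu]_x (g x)%:E.
Proof.
move=> mg gN fg; have mg' : measurable_fun setT (EFin \o g).
  exact/measurable_EFinP.
rewrite [LHS]integralE [RHS]integralE; congr (_ - _).
- apply: ge0_integral_eq_off_null => //.
  + exact: measurable_funepos.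
  + move=> x; have [/gN gx|/fg fx] := pselect (N x); last first.
      by rewrite !funeposE fx.
    by rewrite !funeposE gx maxxx le_max lexx orbT.
  + by move=> x /fg fx; rewrite !funeposE fx.
- apply: ge0_integral_eq_off_null => //.
  + exact: measurable_funeneg.
  + move=> x; have [/gN gx|/fg fx] := pselect (N x); last first.
      by rewrite !funenegE fx.
    by rewrite !funenegE gx oppe0 maxxx le_max lexx orbT.
  + by move=> x /fg fx; rewrite !funenegE fx.
Qed.

End null_sets.

(** * Exceptional spheres, decay at infinity, and the divergence theorem *)

Section spheres.
Context {R : realType}.
Notation vec := 'rV[R]_3.
Notation mu := (@lebesgue_measure R).
Notation TR := (measurableTypeR R).
Implicit Types (L : seq (vec * R)) (f F : vec -> R).

Definition line (x : vec) (m : 'I_3) (t : R) : vec := x + t *: 'e_m.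

Lemma lineE x m t k : line x m t 0 k = x 0 k + t * (k == m)%:R.
Proof. by rewrite !mxE eqxx. Qed.

Lemma continuous_line x m : continuous (line x m).
Proof.
move=> t; apply: cvgD; first exact: cvg_cst.
by apply: cvgZl; exact: cvg_id.
Qed.

Lemma continuous_coord k : continuous (fun x : vec => x 0 k).
Proof. exact: coord_continuous. Qed.

Lemma cont_add (T : topologicalType) (f g : T -> R) x :
  {for x, continuous f} -> {for x, continuous g} ->
  {for x, continuous (fun y => f y + g y)}.
Proof. by move=> cf cg; exact: cvgD. Qed.

Lemma cont_mul (T : topologicalType) (f g : T -> R) x :
  {for x, continuous f} -> {for x, continuous g} ->
  {for x, continuous (fun y => f y * g y)}.
Proof. by move=> cf cg; exact: cvgM. Qed.

Lemma continuous_sqn : continuous (@sqn R).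
Proof.
rewrite (_ : @sqn R = fun x => x 0 o0 * x 0 o0 + x 0 o1 * x 0 o1 + x 0 o2 * x 0 o2).
  have c k : continuous (fun y : vec => y 0 k * y 0 k).
    by move=> x; exact: cont_mul (@continuous_coord k x) (@continuous_coord k x).
  by move=> x; exact: cont_add (cont_add (c _ _) (c _ _)) (c _ _).
by apply/funext => x; rewrite /sqn sum3E !expr2.
Qed.

(** The two difference quotients are the same function of the increment. *)
Lemma is_derive_line F x m t (d : R) :
  is_derive (line x m t) 'e_m F d <-> is_derive t 1 (fun s => F (line x m s)) d.
Proof.
have E : (fun h => h^-1 *: ((F \o shift (line x m t)) (h *: 'e_m)
           - F (line x m t))) =
    (fun h => h^-1 *: (((fun s => F (line x m s)) \o shift t) (h *: 1)
           - F (line x m t))).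
  apply/funext => h /=; congr (_ *: (F _ - _)).
  by rewrite /line /shift /= scalerDl [_ *: 1]mulr1 addrCA.
by split=> -[dF vF]; split; move: dF vF; rewrite /derivable /derive E.
Qed.

Lemma continuous_subr (c : vec) : continuous (fun x : vec => x - c).
Proof.
move=> x.
exact: (@continuousB R vec vec id (cst c) x cvg_id (@cst_continuous _ _ c x)).
Qed.

(* [c.2] is the squared radius of the sphere with centre [c.1]. *)
Definition off L (x : vec) : bool := all (fun c => sqn (x - c.1) != c.2) L.

Lemma open_off L : open [set x | off L x].
Proof.
elim: L => [|c L IH].
  by rewrite [X in open X](_ : _ = setT) ?predeqE//; exact: openT.
rewrite [X in open X](_ : _ =
    (fun x => sqn (x - c.1)) @^-1` [set~ c.2] `&` [set x | off L x]).
  apply: openI IH; apply: open_comp => [x _|].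
    apply: continuous_comp; last exact: continuous_sqn.
    exact: continuous_subr.
  by apply: closed_openC; exact: closed_eq.
by apply/predeqP => x; split => [/andP[/eqP]|[/eqP ? ?]] //; apply/andP.
Qed.

(** Roots [t] of [t^2 + 2 t y_m + |y|^2 = c.2], where the line meets the sphere. If the discriminant
    is negative, [Num.sqrt] returns 0 and a harmless extra parameter is listed. *)
Definition poles L (x : vec) (m : 'I_3) : seq R :=
  flatten [seq let y := x - c.1 in let D := y 0 m ^+ 2 - sqn y + c.2 in
           [:: - y 0 m + Num.sqrt D; - y 0 m - Num.sqrt D] | c <- L].

Lemma sqn_line (x : vec) m t : sqn (line x m t) = sqn x + 2 * t * x 0 m + t ^+ 2.
Proof.
rewrite /sqn !sum3E !lineE.
by elim/ord3_ind: m; rewrite /=; ring.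
Qed.

Lemma off_line L x m t : t \notin poles L x m -> off L (line x m t).
Proof.
elim: L => [//|c L IH]; rewrite /poles /= !inE !negb_or.
move=> /and3P[t1 t2 tL]; rewrite IH// andbT.
have -> : line x m t - c.1 = line (x - c.1) m t by rewrite /line addrAC.
rewrite sqn_line; set y := x - c.1; apply/eqP => E.
have D : y 0 m ^+ 2 - sqn y + c.2 = (t + y 0 m) ^+ 2 by rewrite -E; ring.
move: t1 t2; rewrite -/y D sqrtr_sqr; case: ger0P => _ /eqP t1 /eqP t2.
- by apply: t1; ring.
- by apply: t2; ring.
Qed.

(** Every line in the last direction meets the spheres in finitely many points, so all sections are
    null. *)
Lemma leb3_off0 L : leb3 (V3 @^-1` [set x | ~~ off L x]) = 0%E.
Proof.
set N := V3 @^-1` _.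
transitivity (\int[leb2]_p (mu \o xsection N) p)%E; first by [].
apply: integral0_eq => p _; rewrite /comp.
apply: countable_lebesgue_measure0; apply/finite_set_countable.
apply: (@sub_finite_set _ _ [set` poles L (V3 (p, 0)) o2]); last first.
  exact: finite_seq.
move=> t; rewrite /xsection /= inE /=; apply: contraNP => /negP h.
rewrite (_ : V3 (p, t) = line (V3 (p, 0)) o2 t) ?off_line//.
apply/rowP => k; rewrite lineE !V3E /=.
by elim/ord3_ind: k; rewrite /= ?mulr0 ?addr0 ?mulr1 ?add0r.
Qed.

(** The default 0 makes a function that is continuous off the spheres measurable on the whole space,
    whatever value [pd] takes on them. *)
Definition cut L f (x : vec) : R := if off L x then f x else 0.

Lemma measurable_cut L f : (forall x, off L x -> {for x, continuous f}) ->
  measurable_fun setT (fun z : (TR * TR * TR)%type => cut L f (V3 z)).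
Proof.
move=> cf; have mU := open_preimage_measurable (@open_off L).
have := open_continuous_measurable (@open_off L) cf.
move/(measurable_restrictT _ mU).1; apply: eq_measurable_fun => z _.
rewrite patchE /cut; case: ifPn => [|/negP h]; first by rewrite inE /= => ->.
by rewrite ifF//; apply/negP => ?; apply: h; rewrite inE.
Qed.

Lemma measurable_off0 L : measurable (V3 @^-1` [set x : vec | ~~ off L x]).
Proof.
rewrite [X in measurable X](_ : _ = ~` (V3 @^-1` [set x | off L x])).
  by apply: measurableC; exact: open_preimage_measurable (@open_off L).
by apply/predeqP => z; split => /negP.
Qed.

(** Passage from the integrals of the theorem, whose integrands are uncontrolled on the spheres, to
    integrals of cut functions. *)
Lemma integral3_cut L f g : (forall x, off L x -> {for x, continuous f}) ->
  (forall x, off L x -> g x = f x) ->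
  integral3 g = (\int[leb3]_z (cut L f (V3 z))%:E)%E.
Proof.
move=> cf gf; rewrite /integral3.
apply: (integral_eq_off_null (measurable_off0 L) (leb3_off0 L)).
- exact: measurable_cut.
- by move=> z /= h; rewrite /cut (negbTE h).
- by move=> z /= /negP; rewrite negbK /cut => h; rewrite h gf.
Qed.

(** Substitute for [1 / |x|]: equivalent to it at infinity, bounded at the origin. *)
Definition rho (x : vec) : R := (Num.sqrt (1 + sqn x))^-1.

Lemma sqn_ge0 (x : vec) : 0 <= sqn x.
Proof. by apply: sumr_ge0 => i _; exact: sqr_ge0. Qed.

Lemma rho_gt0 (x : vec) : 0 < rho x.
Proof. by rewrite invr_gt0 sqrtr_gt0 ltr_pwDl// sqn_ge0. Qed.

Lemma rho_le1 (x : vec) : rho x <= 1.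
Proof.
rewrite invf_le1 ?sqrtr_gt0 ?ltr_pwDl ?sqn_ge0//.
by rewrite -[leLHS]sqrtr1 ler_wsqrtr// lerDl sqn_ge0.
Qed.

Lemma rho2 (x : vec) : rho x ^+ 2 = (1 + sqn x)^-1.
Proof. by rewrite exprVn sqr_sqrtr// addr_ge0// sqn_ge0. Qed.

Lemma sqr_coord_le (x : vec) k : x 0 k ^+ 2 <= sqn x.
Proof. by rewrite /sqn (bigD1 k)//= lerDl sumr_ge0// => i _; exact: sqr_ge0. Qed.

Lemma coord_rho_le1 (x : vec) k : `|x 0 k| * rho x <= 1.
Proof.
rewrite -(@ler_pXn2r _ 2) ?nnegrE ?mulr_ge0 ?(ltW (rho_gt0 _))//.
rewrite exprMn rho2 real_normK ?num_real// expr1n ler_pdivrMr ?mul1r.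
  by rewrite ler_wpDl// sqr_coord_le.
by rewrite ltr_pwDl// sqn_ge0.
Qed.

(** Each of the three factors [1 + x_i^2] is at most [1 + |x|^2]. This inequality turns decay of
    order 6 into integrability. *)
Lemma rho6_omega (x : vec) : rho x ^+ 6 <= omega x.
Proof.
rewrite (_ : 6 = 2 * 3)%N// exprM rho2 /omega -[3%N in leLHS]card_ord -prodr_const.
apply: ler_prod => i _; rewrite invr_ge0 addr_ge0 ?sqn_ge0//=.
rewrite lef_pV2 ?posrE ?ltr_pwDl ?sqn_ge0 ?sqr_ge0//.
by rewrite lerD2l sqr_coord_le.
Qed.

(** The order [n] is an integer, so that coordinates count with order -1 and orders add under
    multiplication. *)
Definition decays L (n : int) f :=
  (forall x, off L x -> {for x, continuous f}) /\
  exists C : R, forall x, off L x -> `|f x| <= C * rho x ^ n.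

Lemma decays_omega L f : decays L 6 f ->
  exists C, forall x, `|cut L f x| <= C * omega x.
Proof.
move=> [_ [C fC]]; exists `|C| => x; rewrite /cut; case: ifPn => [/fC h|_].
  rewrite (le_trans h)// (@le_trans _ _ (`|C| * rho x ^ 6))//.
    by rewrite ler_wpM2r// ?ler_norm// exprz_ge0// ltW// rho_gt0.
  by rewrite ler_wpM2l// rho6_omega.
by rewrite normr0 mulr_ge0// omega_ge0.
Qed.

Definition J L f : R := (\int[leb3]_z cut L f (V3 z))%R.

Lemma integrable_cut L f : decays L 6 f ->
  leb3.-integrable setT (fun z => (cut L f (V3 z))%:E).
Proof.
move=> df; have [C fC] := decays_omega df.
apply: le_integrable (integrable_omega C) => //.
  by apply/measurable_EFinP; apply: measurable_cut; case: df.
by move=> z _; rewrite !abse_EFin lee_fin (le_trans (fC _))// ler_norm.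
Qed.

Lemma integral_cut L f : decays L 6 f ->
  (\int[leb3]_z (cut L f (V3 z))%:E)%E = (J L f)%:E.
Proof.
move=> df; rewrite /J /Rintegral fineK//; apply: integrable_fin_num => //.
exact: integrable_cut.
Qed.

Lemma omega_line (b : vec) m t : b 0 m = 0 -> omega (line b m t) <= (1 + t ^+ 2)^-1.
Proof.
move=> bm; rewrite /omega (bigD1 m)//= lineE eqxx mulr1 bm add0r.
rewrite -[leRHS]mulr1 ler_wpM2l ?oneDsqr_inv_ge0//.
by apply: prodr_ile1 => i _; rewrite oneDsqr_inv_ge0 oneDsqr_inv_le1.
Qed.

Lemma cont_cut L f x : off L x -> {for x, continuous f} ->
  {for x, continuous (cut L f)}.
Proof.
move=> ox cf; have E : cut L f x = f x by rewrite /cut ox.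
change (cut L f @ x --> cut L f x); rewrite E.
have nU : nbhs x [set y | off L y].
  by apply: open_nbhs_nbhs; split => //; exact: open_off.
have nE : \forall y \near x, f y = cut L f y.
  by apply: filterS nU => y /= oy; rewrite /cut oy.
exact: cvg_trans (near_eq_cvg nE) cf.
Qed.

Lemma integrable_oneDsqr2 (C : R) :
  leb2.-integrable setT
    (fun p => (C * ((1 + p.1 ^+ 2)^-1 * (1 + p.2 ^+ 2)^-1))%:E).
Proof.
under eq_fun do rewrite EFinM.
have mw := @measurable_oneDsqr_inv R; have w0 := @oneDsqr_inv_ge0 R.
have mw2 : measurable_fun setT
    (fun p : TR * TR => (1 + p.1 ^+ 2)^-1 * (1 + p.2 ^+ 2)^-1).
  by apply: measurable_funM; apply: (measurableT_comp mw).
apply: integrableZl => //; apply/integrableP; split.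
  by apply/measurable_EFinP.
under eq_integral do rewrite gee0_abs ?lee_fin ?mulr_ge0//.
have := @integral_prod_sep R _ _ _ _ mu mu _ _ mw mw w0 w0.
by rewrite /= => ->; rewrite integral_oneDsqr_inv -!EFinM ltry.
Qed.

(** Fubini's theorem, with the order of integration chosen so that direction [m] comes innermost;
    the parameter along a line is normalized by [b 0 m = 0]. *)
Lemma J_lines0 L f m : decays L 6 f ->
  (forall b : vec, b 0 m = 0 ->
    measurable_fun setT (fun t : TR => cut L f (line b m t)) ->
    (\int[mu]_t (cut L f (line b m t))%:E = 0)%E) ->
  J L f = 0.
Proof.
move=> df H; have iD := integrable_cut df.
have mD : measurable_fun setT (fun z : TR * TR * TR => cut L f (V3 z)).
  by apply: measurable_cut; case: df.
(* Fubini alone yields almost every section; the pointwise bound by [omega] yields all of them. *)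
have isec y : leb2.-integrable setT (fun p : TR * TR => (cut L f (V3 (p, y)))%:E).
  have [C fC] := decays_omega df.
  apply: le_integrable (integrable_oneDsqr2 `|C|) => //.
    by apply/measurable_EFinP; exact: measurableT_comp mD (pair2_measurable y).
  move=> p _; rewrite !abse_EFin lee_fin (le_trans (fC _))// omega_V3 /=.
  rewrite normrM normr_id ger0_norm ?mulr_ge0 ?oneDsqr_inv_ge0//.
  rewrite (@le_trans _ _ (`|C| * ((1 + p.1 ^+ 2)^-1 / (1 + p.2 ^+ 2)
      / (1 + y ^+ 2))))//.
    by rewrite ler_wpM2r ?ler_norm// !mulr_ge0 ?oneDsqr_inv_ge0.
  by rewrite ler_wpM2l// ler_piMr ?mulr_ge0 ?oneDsqr_inv_ge0 ?oneDsqr_inv_le1.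
have inner (q : TR -> TR * TR * TR) (b : vec) : measurable_fun setT q ->
    b 0 m = 0 -> (forall t, V3 (q t) = line b m t) ->
    (\int[mu]_t (cut L f (V3 (q t)))%:E = 0)%E.
  move=> mq bm qb; under eq_integral do rewrite qb; apply: H => //.
  apply: (eq_measurable_fun (fun t => cut L f (V3 (q t)))).
    by move=> t _; rewrite qb.
  exact: measurableT_comp mD mq.
rewrite /J /Rintegral (_ : (\int[leb3]_z _)%E = 0%E)//.
elim/ord3_ind: m H inner => _ inner.
- rewrite -(@integral21_prod_meas1 _ _ _ _ R leb2 mu _ iD).
  apply: integral0_eq => z _; rewrite /fubini_G.
  rewrite -(@integral21_prod_meas1 _ _ _ _ R mu mu _ (isec z)).
  apply: integral0_eq => y _; rewrite /fubini_G.
  apply: (inner (fun t => (t, y, z)) (V3 (0, y, z))).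
  + by apply: measurable_fun_pair => //; exact: measurable_fun_pair.
  + by rewrite V3E.
  + move=> t; apply/rowP => k; rewrite lineE !V3E.
    by elim/ord3_ind: k; rewrite /= ?mulr0 ?addr0 ?mulr1 ?add0r.
- rewrite -(@integral21_prod_meas1 _ _ _ _ R leb2 mu _ iD).
  apply: integral0_eq => z _; rewrite /fubini_G.
  rewrite -(@integral12_prod_meas1 _ _ _ _ R mu mu _ (isec z)).
  apply: integral0_eq => x _; rewrite /fubini_F.
  apply: (inner (fun t => (x, t, z)) (V3 (x, 0, z))).
  + by apply: measurable_fun_pair => //; exact: measurable_fun_pair.
  + by rewrite V3E.
  + move=> t; apply/rowP => k; rewrite lineE !V3E.
    by elim/ord3_ind: k; rewrite /= ?mulr0 ?addr0 ?mulr1 ?add0r.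
- rewrite -(@integral12_prod_meas1 _ _ _ _ R leb2 mu _ iD).
  apply: integral0_eq => p _; rewrite /fubini_F.
  apply: (inner (fun t => (p, t)) (V3 (p, 0))).
  + by apply: measurable_fun_pair.
  + by rewrite V3E.
  + move=> t; apply/rowP => k; rewrite lineE !V3E.
    by elim/ord3_ind: k; rewrite /= ?mulr0 ?addr0 ?mulr1 ?add0r.
Qed.

Section divergence.
Variables (L : seq (vec * R)) (m : 'I_3) (F D : vec -> R).
Hypotheses (cF : continuous F) (bF : exists C, forall x, `|F x| <= C * rho x).
Hypothesis dF : forall x, off L x -> is_derive x 'e_m F (D x).
Hypothesis dD : decays L 6 D.

Lemma integral_line0 (b : vec) : b 0 m = 0 ->
  measurable_fun setT (fun t : TR => cut L D (line b m t)) ->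
  (\int[mu]_t (cut L D (line b m t))%:E = 0)%E.
Proof.
move=> bm mD; have [cD _] := dD.
(* Because [b 0 m = 0], the [m]-th coordinate on the line is [t], so [|t| rho <= 1] and
   [|F| <= |C| / |t|]. *)
have Fsmall (e : R) : 0 < e -> exists K : R, forall t, K <= `|t| -> `|F (line b m t)| <= e.
  move=> e0; have [C FC] := bF; exists (`|C| / e + 1) => t tK.
  have t0 : 0 < `|t| by rewrite (lt_le_trans _ tK)// ltr_wpDl// divr_ge0// ltW.
  rewrite (le_trans (FC _))// (@le_trans _ _ (`|C| / `|t|))//.
    have := coord_rho_le1 (line b m t) m; rewrite lineE eqxx mulr1 bm add0r => h.
    rewrite (@le_trans _ _ (`|C| * rho (line b m t)))//.
      by rewrite ler_wpM2r ?ler_norm// ltW// rho_gt0.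
    by rewrite ler_wpM2l// -[leRHS]mul1r ler_pdivlMr// mulrC.
  by rewrite ler_pdivrMr// mulrC -ler_pdivrMr// (le_trans _ tK)// lerDl.
have Fy : F (line b m t) @[t --> +oo] --> 0.
  apply/cvgrPdist_le => e /Fsmall[K hK].
  apply: filterS (nbhs_pinfty_ge (num_real K)) => t Kt.
  by rewrite sub0r normrN hK// (le_trans Kt)// ler_norm.
have FNy : F (line b m t) @[t --> -oo] --> 0.
  apply/cvgrPdist_le => e /Fsmall[K hK].
  apply: filterS (nbhs_ninfty_le (num_real (- K))) => t Kt.
  by rewrite sub0r normrN hK// -normrN (le_trans _ (ler_norm _))// lerNr.
apply: (@integral_derive_line R (poles L b m) _ (fun t => F (line b m t))).
- by move=> t; apply: continuous_comp; [exact: continuous_line|exact: cF].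
- move=> t /off_line ot; split.
    by rewrite /cut ot; apply/is_derive_line; exact: dF.
  apply: (@continuous_comp _ _ _ (line b m) (cut L D)).
    exact: continuous_line.
  by apply: cont_cut => //; exact: cD.
- have [C DC] := decays_omega dD.
  apply: le_integrable (integrable_oneDsqr_inv `|C|) => //.
    exact/measurable_EFinP.
  move=> t _; rewrite !abse_EFin lee_fin (le_trans (DC _))//.
  rewrite ger0_norm ?mulr_ge0 ?oneDsqr_inv_ge0//.
  rewrite (@le_trans _ _ (`|C| * omega (line b m t)))//.
    by rewrite ler_wpM2r ?omega_ge0// ler_norm.
  by rewrite ler_wpM2l// omega_line.
- exact: Fy.
- exact: FNy.
Qed.

Lemma J_derive0 : J L D = 0.
Proof. by apply: (J_lines0 (m := m)) => // b; exact: integral_line0. Qed.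

End divergence.

End spheres.

(** * Calculus of decay orders and linearity of [J] *)

Section decay_algebra.
Context {R : realType}.
Notation vec := 'rV[R]_3.
Implicit Types (L : seq (vec * R)) (f g : vec -> R).

Lemma decays_le L (n m : int) f : (m <= n) -> decays L n f -> decays L m f.
Proof.
move=> mn [cf [C fC]]; split=> //; exists `|C| => x ox; rewrite (le_trans (fC _ ox))//.
rewrite (@le_trans _ _ (`|C| * rho x ^ n))//.
  by rewrite ler_wpM2r ?ler_norm// exprz_ge0// ltW// rho_gt0.
rewrite ler_wpM2l// -(subrK m n) expfzDr ?gt_eqF ?rho_gt0//.
rewrite ler_piMl ?exprz_ge0 ?(ltW (rho_gt0 _))//.
have : 0 <= n - m by rewrite subr_ge0.
case: (n - m) => // k _; apply: exprn_ile1; last exact: rho_le1.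
exact/ltW/rho_gt0.
Qed.

Lemma decays_ext L n f g : (forall x, off L x -> f x = g x) ->
  decays L n f -> decays L n g.
Proof.
move=> fg [cf [C fC]]; split; last by exists C => x ox; rewrite -fg// fC.
move=> x ox; have nU : nbhs x [set y | off L y].
  by apply: open_nbhs_nbhs; split => //; exact: open_off.
have nE : \forall y \near x, f y = g y by apply: filterS nU => y /=; exact: fg.
change (g @ x --> g x); rewrite -fg//.
exact: cvg_trans (near_eq_cvg nE) (cf x ox).
Qed.

Lemma decays_cst L (c : R) : decays L 0 (fun=> c).
Proof.
split=> [x _|]; first exact: cst_continuous.
by exists `|c| => x _; rewrite expr0z mulr1.
Qed.

Lemma decays0 L n : decays L n (fun=> 0).
Proof.
split=> [x _|]; first exact: cst_continuous.
by exists 0 => x _; rewrite normr0 mul0r.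
Qed.

Lemma decays_coord L k : decays L (-1) (fun x => x 0 k).
Proof.
split=> [x _|]; first exact: continuous_coord.
exists 1 => x _; rewrite mul1r exprN1.
by rewrite -[leRHS]mul1r ler_pdivlMr ?rho_gt0// coord_rho_le1.
Qed.

Lemma decays_add L n f g :
  decays L n f -> decays L n g -> decays L n (fun x => f x + g x).
Proof.
move=> [cf [C fC]] [cg [D gD]]; split=> [x ox|].
  by apply: cont_add; [exact: cf|exact: cg].
exists (C + D) => x ox; rewrite (le_trans (ler_normD _ _))// mulrDl.
by rewrite lerD// ?fC ?gD.
Qed.

Lemma decays_mul L n m f g :
  decays L n f -> decays L m g -> decays L (n + m) (fun x => f x * g x).
Proof.
move=> [cf [C fC]] [cg [D gD]]; split=> [x ox|].
  by apply: cont_mul; [exact: cf|exact: cg].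
exists (C * D) => x ox; rewrite normrM expfzDr ?gt_eqF ?rho_gt0// mulrACA.
by rewrite ler_pM// ?fC ?gD.
Qed.

Lemma decays_scale L n (c : R) f : decays L n f -> decays L n (fun x => c * f x).
Proof. by move=> df; rewrite -[n]add0r; apply: decays_mul => //; exact: decays_cst. Qed.

Lemma decays_opp L n f : decays L n f -> decays L n (fun x => - f x).
Proof.
move=> /(decays_scale (-1)); apply: decays_ext => x _; exact: mulN1r.
Qed.

Lemma decays_sub L n f g :
  decays L n f -> decays L n g -> decays L n (fun x => f x - g x).
Proof. by move=> df dg; apply: decays_add => //; exact: decays_opp. Qed.

Lemma decays_sum L n I (r : seq I) (F : I -> vec -> R) :
  (forall i, decays L n (F i)) -> decays L n (fun x => \sum_(i <- r) F i x).
Proof.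
move=> dF; elim: r => [|i r IH].
  by apply: decays_ext (decays0 L n) => x _; rewrite big_nil.
by apply: decays_ext (decays_add (dF i) IH) => x _; rewrite big_cons.
Qed.

(** Squared, this is [1 + |x|^2 <= 2 (1 + |c|^2) (1 + |x - c|^2)]. *)
Lemma rho_shift (c : vec) : exists K, forall x, rho (x - c) <= K * rho x.
Proof.
exists (Num.sqrt (2 * (1 + sqn c))) => x.
have pos y : 0 < 1 + sqn y :> R by rewrite ltr_pwDl// sqn_ge0.
rewrite /rho -sqrtrV ?(ltW (pos _))// -sqrtrV ?(ltW (pos _))//.
rewrite -sqrtrM ?mulr_ge0 ?(ltW (pos _))// ler_wsqrtr//.
rewrite ler_pdivlMr// mulrC ler_pdivrMr// /sqn !sum3E !mxE.
have h (a b : R) : a ^+ 2 <= 2 * (b ^+ 2 + (a - b) ^+ 2).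
  by have := sqr_ge0 (2 * b - a); lra.
have := h (x 0 o0) (c 0 o0); have := h (x 0 o1) (c 0 o1).
have := h (x 0 o2) (c 0 o2).
have : 0 <= (c 0 o0 ^+ 2 + c 0 o1 ^+ 2 + c 0 o2 ^+ 2) *
  ((x 0 o0 - c 0 o0) ^+ 2 + (x 0 o1 - c 0 o1) ^+ 2 + (x 0 o2 - c 0 o2) ^+ 2).
  by rewrite mulr_ge0 ?addr_ge0 ?sqr_ge0.
by lra.
Qed.

(** The order is a natural number because the one-sided comparison of [rho (x - c)] with [rho x] is
    raised to the power [n]. *)
Lemma decays_shift L L' (n : nat) (c : vec) f :
  (forall x, off L x -> off L' (x - c)) ->
  decays L' n f -> decays L n (fun x => f (x - c)).
Proof.
move=> LL' [cf [C fC]]; have [K hK] := rho_shift c; split=> [x ox|].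
  apply: (@continuous_comp _ _ _ (fun y : vec => y - c) f).
    exact: continuous_subr.
  exact/cf/LL'.
exists (`|C| * K ^+ n) => x ox; rewrite (le_trans (fC _ (LL' _ ox)))//.
rewrite (@le_trans _ _ (`|C| * rho (x - c) ^+ n))//.
  by rewrite ler_wpM2r ?ler_norm// exprn_ge0// ltW// rho_gt0.
rewrite -mulrA ler_wpM2l// -exprMn; apply: lerXn2r; rewrite ?nnegrE ?hK//.
  by rewrite ltW// rho_gt0.
by rewrite (le_trans _ (hK x))// ltW// rho_gt0.
Qed.

Lemma J_ext L f g : (forall x, off L x -> f x = g x) -> J L f = J L g.
Proof.
move=> fg; apply: eq_Rintegral => z _; rewrite /cut.
by case: ifPn => // /fg.
Qed.

Lemma J_add L f g : decays L 6 f -> decays L 6 g ->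
  J L (fun x => f x + g x) = J L f + J L g.
Proof.
move=> df dg; rewrite /J -RintegralD//=; [|exact: integrable_cut..].
by apply: eq_Rintegral => z _; rewrite /cut; case: ifPn; rewrite ?addr0.
Qed.

Lemma J_scale L c f : decays L 6 f -> J L (fun x => c * f x) = c * J L f.
Proof.
move=> df; rewrite /J -RintegralZl//=; last exact: integrable_cut.
by apply: eq_Rintegral => z _; rewrite /cut; case: ifPn; rewrite ?mulr0.
Qed.

Lemma J0 L : J L (fun=> 0) = 0.
Proof.
by rewrite -[RHS](mul0r (J L (fun=> 0))) -J_scale ?mul0r//; exact: decays0.
Qed.

Lemma J_sum L I (r : seq I) (F : I -> vec -> R) : (forall i, decays L 6 (F i)) ->
  J L (fun x => \sum_(i <- r) F i x) = \sum_(i <- r) J L (F i).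
Proof.
move=> dF; elim: r => [|i r IH].
  by rewrite big_nil -[RHS](J0 L); apply: J_ext => x _; rewrite big_nil.
rewrite big_cons -IH -J_add//; last exact: decays_sum.
by apply: J_ext => x _; rewrite big_cons.
Qed.

Lemma J_abs_le L f g : decays L 6 f -> decays L 6 g ->
  (forall x, off L x -> `|f x| <= g x) -> `|J L f| <= J L g.
Proof.
move=> df dg fg; rewrite (le_trans (le_normr_Rintegral _ _))//.
  exact: integrable_cut.
apply: le_Rintegral => //.
- exact: (integrable_norm (integrable_cut df)).
- exact: integrable_cut.
- by move=> z _; rewrite /cut; case: ifPn => [/fg|]//; rewrite normr0.
Qed.

End decay_algebra.

(** * Rules for directional derivatives, in a form that matches pointwise expressions *)

Section derivative_rules.
Context {R : realType}.
Notation vec := 'rV[R]_3.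

Section rules.
Context {V : normedModType R}.
Implicit Types (f g : V -> R) (x v : V).

Lemma dv_eq x v f (d d' : R) : is_derive x v f d -> d = d' -> is_derive x v f d'.
Proof. by move=> + <-. Qed.

Lemma dv_cst x v (c : R) : is_derive x v (fun=> c) 0.
Proof. exact: is_derive_cst. Qed.

Lemma dv_add x v f g (df dg : R) : is_derive x v f df -> is_derive x v g dg ->
  is_derive x v (fun y => f y + g y) (df + dg).
Proof. exact: is_deriveD. Qed.

Lemma dv_sub x v f g (df dg : R) : is_derive x v f df -> is_derive x v g dg ->
  is_derive x v (fun y => f y - g y) (df - dg).
Proof. exact: is_deriveB. Qed.

Lemma dv_opp x v f (df : R) : is_derive x v f df ->
  is_derive x v (fun y => - f y) (- df).
Proof. exact: is_deriveN. Qed.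

Lemma dv_mul x v f g (df dg : R) : is_derive x v f df -> is_derive x v g dg ->
  is_derive x v (fun y => f y * g y) (f x * dg + g x * df).
Proof. exact: is_deriveM. Qed.

Lemma dv_sum x v I (r : seq I) (F : I -> V -> R) (dF : I -> R) :
  (forall i, is_derive x v (F i) (dF i)) ->
  is_derive x v (fun y => \sum_(i <- r) F i y) (\sum_(i <- r) dF i).
Proof.
move=> h; elim: r => [|i r IH].
  rewrite big_nil (_ : (fun y => _) = fun=> 0); first exact: dv_cst.
  by apply/funext => y; rewrite big_nil.
rewrite big_cons (_ : (fun y => _) = fun y => F i y + \sum_(i <- r) F i y).
  exact: dv_add.
by apply/funext => y; rewrite big_cons.
Qed.

End rules.

Implicit Types (f g : vec -> R) (x v : vec).

Lemma dv_coord x m k : is_derive x 'e_m (fun y => y 0 k) (k == m)%:R.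
Proof.
have E : (fun h : R => h^-1 *: (((fun y : vec => y 0 k) \o shift x) (h *: 'e_m)
          - x 0 k)) @ 0^' --> ((k == m)%:R : R).
  apply: cvg_near_cst; near=> h.
  rewrite /= !mxE eqxx /= addrK scalerA.
  rewrite mulVf ?scale1r//; near: h; exact: nbhs_dnbhs_neq.
split; first by apply/cvg_ex; eexists; exact: E.
by apply/cvg_lim => //; exact: E.
Unshelve. all: by end_near. Qed.

Lemma dv_comp x m f (g : R -> R) (df dg : R) :
  is_derive x 'e_m f df -> is_derive (f x) 1 g dg ->
  is_derive x 'e_m (fun y => g (f y)) (df * dg).
Proof.
have x0 : line x m 0 = x by rewrite /line scale0r addr0.
have lineP (F : vec -> R) (d : R) : is_derive x 'e_m F d <->
    is_derive (0 : R) 1 (fun s => F (line x m s)) d.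
  have E := @is_derive_line R F x m 0 d.
  rewrite x0 in E.
  exact: E.
move=> /lineP hf hg; apply/lineP.
rewrite mulrC; apply: (@is_derive1_comp _ g (fun s => f (line x m s))) => //.
by rewrite x0.
Qed.

End derivative_rules.

(* Coefficients, as functions of [t = |x|^2], of the fields
     8 pi u = a A x + b A^T x + c x (x . A x),   8 pi p = d (x . A x);
   [ri1], [ri2] stand for the derivatives of [ri], and [rf] is the coefficient of
   the blob in  - Delta u + grad p = (A grad) f. *)
Record radial (R : Type) := Radial {
  ra : R -> R; ra1 : R -> R; ra2 : R -> R;
  rb : R -> R; rb1 : R -> R; rb2 : R -> R;
  rc : R -> R; rc1 : R -> R; rc2 : R -> R;
  rd : R -> R; rd1 : R -> R; rf : R -> R; rf1 : R -> R }.

(** * Fields built from [A] and radial coefficients: derivatives and Stokes equations *)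

Section radial_fields.
Context {R : realType}.
Notation vec := 'rV[R]_3.
Notation mat := 'M[R]_3.
Implicit Types (r : radial R) (A : mat) (x : vec).

Definition apx A x k : R := A k o0 * x 0 o0 + A k o1 * x 0 o1 + A k o2 * x 0 o2.
Definition aptx A x k : R := A o0 k * x 0 o0 + A o1 k * x 0 o1 + A o2 k * x 0 o2.
Definition qform A x : R :=
  x 0 o0 * apx A x o0 + x 0 o1 * apx A x o1 + x 0 o2 * apx A x o2.

Definition vel r A x k : R := let t := sqn x in
  (8 * pi)^-1 * (ra r t * apx A x k + rb r t * aptx A x k
   + rc r t * (x 0 k * qform A x)).

Definition gvel r A x k m : R := let t := sqn x in
  (8 * pi)^-1 * (ra r t * A k m + 2 * x 0 m * ra1 r t * apx A x k
   + (rb r t * A m k + 2 * x 0 m * rb1 r t * aptx A x k)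
   + (rc r t * ((k == m)%:R * qform A x + x 0 k * (apx A x m + aptx A x m))
      + 2 * x 0 m * rc1 r t * (x 0 k * qform A x))).

Definition pre r A x : R := (8 * pi)^-1 * (rd r (sqn x) * qform A x).

Definition dpre r A x m : R := let t := sqn x in
  (8 * pi)^-1 * (rd r t * (apx A x m + aptx A x m)
                 + 2 * x 0 m * rd1 r t * qform A x).

Definition blob r x : R := (8 * pi)^-1 * rf r (sqn x).

Definition dblob r x m : R := (8 * pi)^-1 * (2 * x 0 m * rf1 r (sqn x)).

(** The pure second derivative in direction [m]; a Laplacian involves no mixed ones. *)
Definition hvel r A x k m : R := let t := sqn x in
  (8 * pi)^-1 *
  ((4 * x 0 m * ra1 r t * A k m
    + (2 * ra1 r t + 4 * x 0 m ^+ 2 * ra2 r t) * apx A x k)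
  + (4 * x 0 m * rb1 r t * A m k
    + (2 * rb1 r t + 4 * x 0 m ^+ 2 * rb2 r t) * aptx A x k)
  + (4 * x 0 m * rc1 r t
       * ((k == m)%:R * qform A x + x 0 k * (apx A x m + aptx A x m))
    + rc r t * (2 * (k == m)%:R * (apx A x m + aptx A x m) + 2 * x 0 k * A m m)
    + (2 * rc1 r t + 4 * x 0 m ^+ 2 * rc2 r t) * (x 0 k * qform A x))).

(** With the blob term, the row divergence is [Delta u - grad p + (A grad) f], which vanishes inside
    the ball as well as outside. *)
Definition stress r A x k m : R :=
  gvel r A x k m - (k == m)%:R * pre r A x + blob r x * A k m.

Definition dstress r A x k m : R :=
  hvel r A x k m - (k == m)%:R * dpre r A x m + dblob r x m * A k m.

Definition regular r (t : R) : Prop :=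
  [/\ is_derive t 1 (ra r) (ra1 r t) /\ is_derive t 1 (ra1 r) (ra2 r t),
      is_derive t 1 (rb r) (rb1 r t) /\ is_derive t 1 (rb1 r) (rb2 r t),
      is_derive t 1 (rc r) (rc1 r t) /\ is_derive t 1 (rc1 r) (rc2 r t),
      is_derive t 1 (rd r) (rd1 r t)
    & is_derive t 1 (rf r) (rf1 r t)].

(** The first expression is the factor of [x . A x] in the divergence of the velocity; the others
    are the factors of [A x], [A^T x] and [x (x . A x)] in the divergence of the stress. What
    remains in both cases is a multiple of the trace of [A]. *)
Definition stokes_coef r (t : R) : Prop :=
  [/\ 2 * ra1 r t + 2 * rb1 r t + 5 * rc r t + 2 * t * rc1 r t = 0,
      10 * ra1 r t + 4 * t * ra2 r t + 2 * rc r t - rd r t + 2 * rf1 r t = 0,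
      10 * rb1 r t + 4 * t * rb2 r t + 2 * rc r t - rd r t = 0
    & 18 * rc1 r t + 4 * t * rc2 r t - 2 * rd1 r t = 0].

Lemma dv_apx A x k m : is_derive x 'e_m (fun y => apx A y k) (A k m).
Proof.
apply: dv_eq.
  apply: dv_add; [apply: dv_add|]; apply: dv_mul; by [exact: dv_cst|exact: dv_coord].
by elim/ord3_ind: m; rewrite /=; ring.
Qed.

Lemma dv_aptx A x k m : is_derive x 'e_m (fun y => aptx A y k) (A m k).
Proof.
apply: dv_eq.
  apply: dv_add; [apply: dv_add|]; apply: dv_mul; by [exact: dv_cst|exact: dv_coord].
by elim/ord3_ind: m; rewrite /=; ring.
Qed.

Lemma dv_qform A x m :
  is_derive x 'e_m (qform A) (apx A x m + aptx A x m).
Proof.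
apply: dv_eq.
  apply: dv_add; [apply: dv_add|]; apply: dv_mul; by [exact: dv_apx|exact: dv_coord].
by rewrite /apx /aptx; elim/ord3_ind: m; rewrite /=; ring.
Qed.

Lemma dv_sqn x m : is_derive x 'e_m (@sqn R) (2 * x 0 m).
Proof.
rewrite (_ : @sqn R = fun x => x 0 o0 * x 0 o0 + x 0 o1 * x 0 o1 + x 0 o2 * x 0 o2).
  apply: dv_eq.
    by apply: dv_add; [apply: dv_add|]; apply: dv_mul; exact: dv_coord.
  by elim/ord3_ind: m; rewrite /=; ring.
by apply/funext => y; rewrite /sqn sum3E !expr2.
Qed.

Lemma dv_radial x m (g : R -> R) (d : R) : is_derive (sqn x) 1 g d ->
  is_derive x 'e_m (fun y => g (sqn y)) (2 * x 0 m * d).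
Proof. by move=> dg; apply: dv_comp => //; exact: dv_sqn. Qed.

Ltac dv_tac := lazymatch goal with
  | |- is_derive _ _ (fun _ => ?c) _ => exact: dv_cst
  | |- is_derive _ _ (fun y => @?f y - @?g y) _ =>
      refine (dv_sub (f := f) (g := g) _ _); dv_tac
  | |- is_derive _ _ (fun y => @?f y + @?g y) _ =>
      refine (dv_add (f := f) (g := g) _ _); dv_tac
  | |- is_derive _ _ (fun y => @?f y * @?g y) _ =>
      refine (dv_mul (f := f) (g := g) _ _); dv_tac
  | |- is_derive _ _ (fun y => apx _ y _) _ => exact: dv_apx
  | |- is_derive _ _ (fun y => aptx _ y _) _ => exact: dv_aptx
  | |- is_derive _ _ (fun y => qform _ y) _ => exact: dv_qform
  | |- is_derive _ _ (fun y => ?g (sqn y)) _ =>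
      refine (dv_radial (g := g) _ _); eassumption
  | |- _ => exact: dv_coord
  end.

Section pointwise.
Variables (r : radial R) (x : vec).
Hypothesis reg : regular r (sqn x).

Lemma dv_vel A k m : is_derive x 'e_m (fun y => vel r A y k) (gvel r A x k m).
Proof.
case: reg => -[? ?] [? ?] [? ?] ? ?.
by apply: dv_eq; [rewrite /vel; cbv zeta; dv_tac|rewrite /gvel; cbv beta zeta; ring].
Qed.

Lemma dv_gvel A k m :
  is_derive x 'e_m (fun y => gvel r A y k m) (hvel r A x k m).
Proof.
case: reg => -[? ?] [? ?] [? ?] ? ?.
have e : (m == m)%:R = 1 :> R by rewrite eqxx.
by apply: dv_eq; [rewrite /gvel; cbv zeta; dv_tac|rewrite /hvel e; cbv beta zeta; ring].
Qed.

Lemma dv_pre A m : is_derive x 'e_m (pre r A) (dpre r A x m).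
Proof.
case: reg => -[? ?] [? ?] [? ?] ? ?.
by apply: dv_eq; [rewrite /pre; cbv zeta; dv_tac|rewrite /dpre; cbv beta zeta; ring].
Qed.

Lemma dv_blob m : is_derive x 'e_m (blob r) (dblob r x m).
Proof.
case: reg => -[? ?] [? ?] [? ?] ? ?.
by apply: dv_eq; [rewrite /blob; cbv zeta; dv_tac|rewrite /dblob; cbv beta zeta; ring].
Qed.

Lemma dv_stress A k m :
  is_derive x 'e_m (fun y => stress r A y k m) (dstress r A x k m).
Proof.
apply: dv_eq (dv_add (dv_sub (dv_gvel A k m)
  (dv_mul (dv_cst x 'e_m (k == m)%:R) (dv_pre A m)))
  (dv_mul (dv_blob m) (dv_cst x 'e_m (A k m)))) _.
by rewrite /dstress; cbv beta; ring.
Qed.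

Hypothesis st : stokes_coef r (sqn x).

Lemma trE A : \tr A = A o0 o0 + A o1 o1 + A o2 o2.
Proof. by rewrite /mxtrace sum3E. Qed.

Lemma div_gvel A : \tr A = 0 -> \sum_k gvel r A x k k = 0.
Proof.
rewrite trE => trA; rewrite sum3E /gvel !eqxx /=.
set t := sqn x; have [h _ _ _] := st; rewrite -/t in h.
have tE : t = x 0 o0 ^+ 2 + x 0 o1 ^+ 2 + x 0 o2 ^+ 2 by rewrite /t /sqn sum3E.
transitivity ((8 * pi)^-1 * ((ra r t + rb r t) * (A o0 o0 + A o1 o1 + A o2 o2)
  + qform A x * (2 * ra1 r t + 2 * rb1 r t + 5 * rc r t + 2 * t * rc1 r t))).
  move: (ra r t) (ra1 r t) (rb r t) (rb1 r t) (rc r t) (rc1 r t) => a a1 b b1 c c1.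
  rewrite tE /qform /apx /aptx; ring.
by rewrite {}h trA !mulr0 addr0 mulr0.
Qed.

Lemma div_dstress A k : \tr A = 0 -> \sum_m dstress r A x k m = 0.
Proof.
rewrite trE => trA; rewrite sum3E /dstress /hvel /dpre /dblob.
set t := sqn x; have [_ h1 h2 h3] := st; rewrite -/t in h1 h2 h3.
have tE : t = x 0 o0 ^+ 2 + x 0 o1 ^+ 2 + x 0 o2 ^+ 2 by rewrite /t /sqn sum3E.
transitivity ((8 * pi)^-1 * (
   apx A x k * (10 * ra1 r t + 4 * t * ra2 r t + 2 * rc r t - rd r t + 2 * rf1 r t)
 + aptx A x k * (10 * rb1 r t + 4 * t * rb2 r t + 2 * rc r t - rd r t)
 + x 0 k * qform A x * (18 * rc1 r t + 4 * t * rc2 r t - 2 * rd1 r t)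
 + 2 * rc r t * x 0 k * (A o0 o0 + A o1 o1 + A o2 o2))).
  move: (ra1 r t) (ra2 r t) (rb1 r t) (rb2 r t) (rc r t) (rc1 r t) (rc2 r t).
  move: (rd r t) (rd1 r t) (rf1 r t) => d d1 f1 a1 a2 b1 b2 c c1 c2; rewrite tE.
  elim/ord3_ind: k; rewrite /= /qform /apx /aptx; ring.
by rewrite h1 h2 h3 trA !mulr0 !addr0 mulr0.
Qed.

End pointwise.

End radial_fields.

(** * The two explicit extensions of the dipole field into the ball *)

Section coefficients.
Context {R : realType}.
Notation vec := 'rV[R]_3.
Notation mat := 'M[R]_3.

Definition isqrt (t : R) : R := (Num.sqrt t)^-1.

Lemma isqrt_gt0 (t : R) : 0 < t -> 0 < isqrt t.
Proof. by move=> t0; rewrite invr_gt0 sqrtr_gt0. Qed.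

Lemma isqrt2 (t : R) : 0 < t -> isqrt t ^+ 2 = t^-1.
Proof. by move=> t0; rewrite /isqrt exprVn sqr_sqrtr// ltW. Qed.

Lemma is_derive_isqrt (t : R) n : 0 < t ->
  is_derive t 1 (fun t => isqrt t ^+ n) (- (n%:R / 2) * isqrt t ^+ n.+2).
Proof.
move=> t0; have s0 : Num.sqrt t != 0 by rewrite gt_eqF// sqrtr_gt0.
have ds : is_derive t 1 isqrt (- (1 / 2) * isqrt t ^+ 3).
  apply: dv_eq (is_deriveV s0 (is_derive1_sqrt t0)) _.
  rewrite /isqrt /GRing.scale /=; field; exact: s0.
elim: n => [|n IH].
  apply: dv_eq (dv_cst t 1 (1 : R)) _; ring.
rewrite (_ : (fun t => _) = fun t => isqrt t * isqrt t ^+ n); last first.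
  by apply/funext => u; rewrite exprS.
apply: dv_eq (dv_mul ds IH) _; rewrite -natr1 !exprS; ring.
Qed.

Variable eps : R.

Definition tau (t : R) : R := t / eps ^+ 2 - 1.

(* Inside [t < eps^2] a quadratic polynomial in [tau], outside the power
   [g t^(-k/2)] of the exterior solution. *)
Definition piece (k : nat) (c0 c1 c2 g t : R) : R :=
  if t < eps ^+ 2 then eps^-1 ^+ k * (c0 + c1 * tau t + c2 * tau t ^+ 2)
  else g * isqrt t ^+ k.

Hypothesis eps0 : 0 < eps.

Lemma is_derive_tau (t : R) : is_derive t 1 tau (eps^-1 ^+ 2).
Proof.
apply: dv_eq (dv_sub (dv_mul (is_derive_id t (1 : R)) (dv_cst t 1 ((eps ^+ 2)^-1)))
  (dv_cst t 1 (1 : R))) _.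
by rewrite exprVn; ring.
Qed.

(** The slope of [tau] is [eps^-2] and the derivative of [isqrt ^ k] is [- (k / 2) isqrt ^ (k + 2)]:
    both branches raise the exponent by 2, and the family is stable under differentiation. *)
Lemma is_derive_piece k c0 c1 c2 g (t : R) : t != eps ^+ 2 ->
  is_derive t 1 (piece k c0 c1 c2 g)
    (piece k.+2 c1 (2 * c2) 0 (- (k%:R / 2) * g) t).
Proof.
rewrite neq_lt => /orP[te|te].
  rewrite {2}/piece te.
  pose q u := eps^-1 ^+ k * (c0 + c1 * tau u + c2 * (tau u * tau u)).
  have nE : \near t, q t = piece k c0 c1 c2 g t.
    apply: filterS (lt_nbhsl te) => u ue; rewrite /piece ue /q; ring.
  apply: near_eq_is_derive nE _.
  have dt := is_derive_tau t.
  apply: dv_eq (dv_mul (dv_cst t 1 (eps^-1 ^+ k)) (dv_add (dv_add (dv_cst t 1 c0)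
    (dv_mul (dv_cst t 1 c1) dt)) (dv_mul (dv_cst t 1 c2) (dv_mul dt dt)))) _.
  have -> : eps^-1 ^+ k.+2 = eps^-1 ^+ k * eps^-1 ^+ 2 by rewrite -exprD addn2.
  by cbv beta; ring.
rewrite {2}/piece ltNge (ltW te) /=.
have nE : \near t, g * isqrt t ^+ k = piece k c0 c1 c2 g t.
  by apply: filterS (lt_nbhsr te) => u ue; rewrite /piece ltNge (ltW ue).
apply: near_eq_is_derive nE _.
have t0 : 0 < t by rewrite (lt_trans _ te)// exprn_gt0.
apply: dv_eq (dv_mul (dv_cst t 1 g) (is_derive_isqrt k t0)) _.
by cbv beta; ring.
Qed.

(** At the sphere [tau = 0], so the branches take the values [eps^-k c0] and [eps^-k g]. *)
Lemma continuous_piece k c0 c1 c2 g (t : R) : t != eps ^+ 2 \/ c0 = g ->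
  {for t, continuous (piece k c0 c1 c2 g)}.
Proof.
have [->|te] := eqVneq t (eps ^+ 2); last first.
  move=> _; have := @is_derive_piece k c0 c1 c2 g t te.
  by move=> /(@ex_derive _ _ _ _ _ _ _) /derivable1_diffP /differentiable_continuous.
move=> [//|->{c0}].
have e2 : 0 < eps ^+ 2 by rewrite exprn_gt0.
pose q u := eps^-1 ^+ k * (g + c1 * tau u + c2 * (tau u * tau u)).
pose h u := g * isqrt u ^+ k.
have cq : {for eps ^+ 2, continuous q}.
  apply: differentiable_continuous; apply/derivable1_diffP.
  have dt := is_derive_tau (eps ^+ 2).
  apply: (@ex_derive _ _ _ _ _ _ _); exact: (dv_mul (dv_cst _ 1 (eps^-1 ^+ k)) (dv_add (dv_add (dv_cst _ 1 g)
    (dv_mul (dv_cst _ 1 c1) dt)) (dv_mul (dv_cst _ 1 c2) (dv_mul dt dt)))).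
have ch : {for eps ^+ 2, continuous h}.
  apply: differentiable_continuous; apply/derivable1_diffP.
  have := dv_mul (dv_cst (eps ^+ 2) (1 : R) g) (is_derive_isqrt k e2).
  by move/(@ex_derive _ _ _ _ _ _ _).
have qe : q (eps ^+ 2) = piece k g c1 c2 g (eps ^+ 2).
  rewrite /piece ltxx /q /tau divff ?gt_eqF// subrr /isqrt sqrtr_sqr gtr0_norm//.
  ring.
have he : h (eps ^+ 2) = piece k g c1 c2 g (eps ^+ 2) by rewrite /piece ltxx.
apply/cvgrPdist_lt => d d0.
move: cq => /cvgrPdist_lt /(_ _ d0); rewrite qe => cq.
move: ch => /cvgrPdist_lt /(_ _ d0); rewrite he => ch.
apply: filterS2 cq ch => u hq hh.
have -> : piece k g c1 c2 g u = if u < eps ^+ 2 then q u else h u.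
  by rewrite /piece /q expr2.
by case: ifP.
Qed.

Lemma tau_bound t : 0 <= t -> t < eps ^+ 2 -> `|tau t| <= 1.
Proof.
move=> t0 te; have e2 : 0 < eps ^+ 2 by rewrite exprn_gt0.
have h : 0 <= t / eps ^+ 2 by rewrite divr_ge0// ltW.
have h' : t / eps ^+ 2 < 1 by rewrite ltr_pdivrMr// mul1r.
by rewrite /tau ler_norml; apply/andP; split; lra.
Qed.

Lemma decays_piece (L : seq (vec * R)) (k : nat) (c0 c1 c2 g : R) :
  (0, eps ^+ 2) \in L \/ c0 = g ->
  decays L k (fun x => piece k c0 c1 c2 g (sqn x)).
Proof.
move=> H; split.
  move=> x ox; apply: (@continuous_comp _ _ _ (@sqn R)); first exact: continuous_sqn.
  apply: continuous_piece; case: H => [H|]; [left|by right].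
  by move: ox => /allP/(_ _ H) /=; rewrite subr0.
(* With this [K], the function [K rho] dominates [1 / eps] in the ball and [1 / |x|] outside it. *)
pose K := Num.sqrt (1 + eps ^+ 2) / eps.
have K0 : 0 < K by rewrite divr_gt0// sqrtr_gt0 ltr_pwDl// sqr_ge0.
exists (K ^+ k * (`|c0| + `|c1| + `|c2| + `|g|)) => x _.
rewrite mulrAC -exprMn.
have e2 : 0 < eps ^+ 2 by rewrite exprn_gt0.
have p1 y : 0 < 1 + sqn y :> R by rewrite ltr_pwDl// sqn_ge0.
have Kr : K * rho x = Num.sqrt ((1 + eps ^+ 2) / (eps ^+ 2 * (1 + sqn x))).
  rewrite /K /rho sqrtrM ?addr_ge0 ?sqr_ge0// sqrtrV ?mulr_ge0 ?ltW//.
  by rewrite sqrtrM ?ltW// sqrtr_sqr gtr0_norm// invfM mulrA.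
have Kr0 : 0 <= K * rho x by rewrite mulr_ge0 ?(ltW K0) ?(ltW (rho_gt0 _)).
have i0 : 0 <= eps^-1 by rewrite invr_ge0 ltW.
rewrite /piece; case: ltP => te.
  have hs : eps^-1 <= K * rho x.
    rewrite Kr -[eps^-1]gtr0_norm ?invr_gt0// -sqrtr_sqr ler_wsqrtr//.
    rewrite exprVn ler_pdivlMr ?mulr_gt0// mulKf ?gt_eqF// lerD2l ltW//.
  rewrite normrM; apply: ler_pM => //.
    by rewrite normrX ger0_norm//; apply: lerXn2r.
  have tb := tau_bound (sqn_ge0 x) te.
  rewrite (le_trans (ler_normD _ _))// -[leLHS]addr0 lerD//.
  rewrite lerD//; first rewrite (le_trans (ler_normD _ _))// lerD//.
    by rewrite normrM ler_piMr.
  by rewrite normrM ler_piMr// normrX exprn_ile1.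
have s0 : 0 < sqn x by rewrite (lt_le_trans _ te).
have hs : isqrt (sqn x) <= K * rho x.
  rewrite Kr /isqrt -sqrtrV ?(ltW s0)// ler_wsqrtr//.
  rewrite ler_pdivlMr ?mulr_gt0// mulrC ler_pdivrMr//.
  by rewrite mulrDr mulrDl mulr1 mul1r lerD2r.
rewrite normrM mulrC; apply: ler_pM => //.
  have i1 := ltW (isqrt_gt0 s0).
  by rewrite normrX ger0_norm//; apply: lerXn2r.
by rewrite lerDr !addr_ge0.
Qed.

Lemma is_derive_piece_eq k c0 c1 c2 g d0 d1 d2 h (t : R) : t != eps ^+ 2 ->
  d0 = c1 -> d1 = 2 * c2 -> d2 = 0 -> h = - (k%:R / 2) * g ->
  is_derive t 1 (piece k c0 c1 c2 g) (piece k.+2 d0 d1 d2 h t).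
Proof. by move=> te -> -> -> ->; exact: is_derive_piece. Qed.

(* The Taylor polynomial of degree 4 of [sqrt] at [eps^2] replaces [|x|] by a C^4
   function inside the ball, and with it the Oseen tensor by a C^2 one. *)
Definition smooth_coef : radial R := Radial
  (piece 3 (-1) (3 / 2) (-15) (-1)) (piece 5 (3 / 2) (-30) 0 (3 / 2))
  (piece 7 (-30) 0 0 (- (15 / 4)))
  (piece 3 1 (- (3 / 2)) (15 / 8) 1) (piece 5 (- (3 / 2)) (15 / 4) 0 (- (3 / 2)))
  (piece 7 (15 / 4) 0 0 (15 / 4))
  (piece 5 (-3) (15 / 2) 0 (-3)) (piece 7 (15 / 2) 0 0 (15 / 2))
  (piece 9 0 0 0 (- (105 / 4)))
  (piece 5 (-6) (135 / 2) 0 (-6)) (piece 7 (135 / 2) 0 0 15)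
  (piece 3 0 (105 / 2) (945 / 8) 0) (piece 5 (105 / 2) (945 / 4) 0 0).

(* Interior Stokes solution with the boundary values of the dipole field. *)
Definition interior_coef : radial R := Radial
  (piece 3 (-1) (15 / 4) 0 (-1)) (piece 5 (15 / 4) 0 0 (3 / 2))
  (piece 7 0 0 0 (- (15 / 4)))
  (piece 3 1 (15 / 4) 0 1) (piece 5 (15 / 4) 0 0 (- (3 / 2)))
  (piece 7 0 0 0 (15 / 4))
  (piece 5 (-3) 0 0 (-3)) (piece 7 0 0 0 (15 / 2))
  (piece 9 0 0 0 (- (105 / 4)))
  (piece 5 (63 / 2) 0 0 (-6)) (piece 7 0 0 0 15)
  (piece 3 0 0 0 0) (piece 5 0 0 0 0).

Lemma regular_smooth t : t != eps ^+ 2 -> regular smooth_coef t.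
Proof.
by move=> te; split; [split|split|split| |]; apply: is_derive_piece_eq => //; field.
Qed.

Lemma regular_interior t : t != eps ^+ 2 -> regular interior_coef t.
Proof.
by move=> te; split; [split|split|split| |]; apply: is_derive_piece_eq => //; field.
Qed.

(** Write [phi] for the Taylor polynomial inside and for [sqrt] outside. Contracting the gradient of
    [Delta phi Id - nabla^2 phi] with a trace-free [A] gives [a = 16 phi'' + 8 t phi'''],
    [b = - 4 phi''], [c = - 8 phi''']; the pressure [- A : nabla^2 Delta phi] gives
    [d = - 56 phi''' - 16 t phi'''']; the blob is [- Delta^2 phi]. The identities thus hold in
    either branch. *)
Lemma stokes_smooth t : 0 <= t -> stokes_coef smooth_coef t.
Proof.
move=> t0; have e0 : eps != 0 by rewrite gt_eqF.
have e2 : 0 < eps ^+ 2 by rewrite exprn_gt0.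
rewrite /stokes_coef /= /piece; case: ltP => te.
  by rewrite /tau; split; field.
have t1 : 0 < t by rewrite (lt_le_trans _ te).
have s0 : isqrt t != 0 by rewrite gt_eqF// isqrt_gt0.
(* Expressing [t] through [isqrt t] leaves identities between powers of one quantity. *)
have -> : 2 * t = 2 * (isqrt t ^+ 2)^-1 by rewrite isqrt2// invrK.
have -> : 4 * t = 4 * (isqrt t ^+ 2)^-1 by rewrite isqrt2// invrK.
by split; field.
Qed.

(** The ansatz is a cubic velocity and a quadratic pressure: [a], [b] affine in [tau], [c], [d]
    constant. Boundary values fix [c] and the constant terms; the equations then force both slopes
    to be [15 / 4] and [d] to be [63 / 2], up to powers of [eps]. *)
Lemma stokes_interior t : 0 <= t -> stokes_coef interior_coef t.
Proof.
move=> t0; have e0 : eps != 0 by rewrite gt_eqF.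
have e2 : 0 < eps ^+ 2 by rewrite exprn_gt0.
rewrite /stokes_coef /= /piece; case: ltP => te.
  by rewrite /tau; split; field.
have t1 : 0 < t by rewrite (lt_le_trans _ te).
have s0 : isqrt t != 0 by rewrite gt_eqF// isqrt_gt0.
have -> : 2 * t = 2 * (isqrt t ^+ 2)^-1 by rewrite isqrt2// invrK.
have -> : 4 * t = 4 * (isqrt t ^+ 2)^-1 by rewrite isqrt2// invrK.
by split; field.
Qed.

Lemma decays_eqn (L : seq (vec * R)) (n m : int) (f : vec -> R) :
  decays L m f -> m = n -> decays L n f.
Proof. by move=> + <-. Qed.

Lemma decays_apx (L : seq (vec * R)) (A : mat) k : decays L (-1) (fun x => apx A x k).
Proof.
rewrite /apx; do 2?[apply: decays_add]; apply: decays_scale; exact: decays_coord.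
Qed.

Lemma decays_aptx (L : seq (vec * R)) (A : mat) k : decays L (-1) (fun x => aptx A x k).
Proof.
rewrite /aptx; do 2?[apply: decays_add]; apply: decays_scale; exact: decays_coord.
Qed.

Lemma decays_qform (L : seq (vec * R)) (A : mat) : decays L (-2) (qform A).
Proof.
have h k : decays L (-2) (fun x => x 0 k * apx A x k).
  exact: decays_mul (decays_coord L k) (decays_apx L A k).
exact: decays_add (decays_add (h _) (h _)) (h _).
Qed.

Lemma decays_coord2 (L : seq (vec * R)) m : decays L (-2) (fun x => x 0 m ^+ 2).
Proof. exact: decays_mul (decays_coord L m) (decays_coord L m). Qed.

(** The argument [H] decides each [piece]: the right alternative says that its branches match, so no
    sphere is required; the left one excuses a jump by a sphere of [L]. *)
Ltac dec_tac H := lazymatch goal with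
  | |- decays _ _ (fun _ => ?c) => exact: decays_cst
  | |- decays _ _ (fun y => @?f y - @?g y) =>
      refine (decays_sub (f := f) (g := g) _ (decays_eqn _ _));
      [dec_tac H | dec_tac H | reflexivity]
  | |- decays _ _ (fun y => @?f y + @?g y) =>
      refine (decays_add (f := f) (g := g) _ (decays_eqn _ _));
      [dec_tac H | dec_tac H | reflexivity]
  | |- decays _ _ (fun y => @?f y * @?g y) =>
      refine (decays_mul (f := f) (g := g) _ _); dec_tac H
  | |- decays _ _ (fun y => _ ^+ 2) => exact: decays_coord2
  | |- decays _ _ (fun y => apx _ y _) => exact: decays_apx
  | |- decays _ _ (fun y => aptx _ y _) => exact: decays_aptx
  | |- decays _ _ (fun y => qform _ y) => exact: decays_qform
  | |- decays _ _ (fun y => piece _ _ _ _ _ (sqn y)) => apply: decays_piece; H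
  | |- _ => exact: decays_coord
  end.

Lemma decays_vel L A k : decays L 2 (fun x => vel smooth_coef A x k).
Proof.
rewrite /vel /=; cbv zeta; refine (decays_eqn _ _).
dec_tac ltac:(by right).
by [].
Qed.

Lemma decays_gvel L A k m : decays L 3 (fun x => gvel smooth_coef A x k m).
Proof.
rewrite /gvel /=; cbv zeta; refine (decays_eqn _ _).
dec_tac ltac:(by right).
by [].
Qed.

Lemma decays_stress L A k m : decays L 3 (fun x => stress smooth_coef A x k m).
Proof.
rewrite /stress /gvel /pre /blob /=; cbv zeta; refine (decays_eqn _ _).
dec_tac ltac:(by right).
by [].
Qed.

Lemma decays_blob L : decays L 3 (blob smooth_coef).
Proof.
rewrite /blob /=; refine (decays_eqn _ _).
dec_tac ltac:(by right).
by [].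
Qed.

(** Some second-order coefficients jump at radius [eps], hence the membership condition; the
    velocity, its gradient and the stress are continuous across that sphere. *)
Lemma decays_dstress L A k m : (0, eps ^+ 2) \in L ->
  decays L 4 (fun x => dstress smooth_coef A x k m).
Proof.
move=> eL.
rewrite /dstress /hvel /dpre /dblob /=; cbv zeta; refine (decays_eqn _ _).
dec_tac ltac:(by left).
by [].
Qed.

End coefficients.

(** * Dipole and Oseen derivatives in radial form *)

Section dipole_fields.
Context {R : realType}.
Notation vec := 'rV[R]_3.
Notation mat := 'M[R]_3.

Lemma pdE (x : vec) m (f : vec -> R) (d : R) : is_derive x 'e_m f d -> pd m f x = d.
Proof. by case. Qed.

Lemma near_sqn_gt (r : R) (x : vec) : r < sqn x -> \forall y \near x, r < sqn y.
Proof. by move=> xr; exact: (continuous_sqn (lt_nbhsr xr)). Qed.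

Lemma near_sqn_lt (r : R) (x : vec) : sqn x < r -> \forall y \near x, sqn y < r.
Proof. by move=> xr; exact: (continuous_sqn (lt_nbhsl xr)). Qed.

Lemma enormE (x : vec) : enorm x = Num.sqrt (sqn x).
Proof. by []. Qed.

Lemma enorm_ge (r : R) (x : vec) : 0 <= r -> (r <= enorm x) = (r ^+ 2 <= sqn x).
Proof.
move=> r0; rewrite enormE -[in LHS](ger0_norm r0) -sqrtr_sqr ler_sqrt//.
exact: sqn_ge0.
Qed.

Lemma enorm_lt (r : R) (x : vec) : 0 <= r -> (enorm x < r) = (sqn x < r ^+ 2).
Proof. by move=> r0; rewrite !ltNge enorm_ge. Qed.

Lemma oseenE (i k : 'I_3) : (fun y : vec => oseen y i k) =
  (fun y => (8 * pi)^-1 * (isqrt (sqn y) ^+ 1 * (i == k)%:R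
              + isqrt (sqn y) ^+ 3 * (y 0 i * y 0 k))).
Proof.
apply/funext => y; rewrite /oseen !mxE big_ord1 !mxE enormE /isqrt expr1.
by rewrite exprVn.
Qed.

Definition doseen (i k m : 'I_3) (x : vec) : R := (8 * pi)^-1 *
  (- (x 0 m * isqrt (sqn x) ^+ 3 * (i == k)%:R)
   + (isqrt (sqn x) ^+ 3 * ((i == m)%:R * x 0 k + x 0 i * (k == m)%:R)
      - 3 * x 0 m * isqrt (sqn x) ^+ 5 * (x 0 i * x 0 k))).

Lemma dv_isqrt_sqn (x : vec) m n : 0 < sqn x ->
  is_derive x 'e_m (fun y => isqrt (sqn y) ^+ n)
    (- n%:R * x 0 m * isqrt (sqn x) ^+ n.+2).
Proof.
move=> x0; apply: dv_eq (dv_radial m (is_derive_isqrt n x0)) _.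
by field.
Qed.

Lemma dv_oseen (x : vec) i k m : 0 < sqn x ->
  is_derive x 'e_m (fun y => oseen y i k) (doseen i k m x).
Proof.
move=> x0; rewrite oseenE.
apply: dv_eq (dv_mul (dv_cst x 'e_m ((8 * pi)^-1)) (dv_add
  (dv_mul (dv_isqrt_sqn m 1 x0) (dv_cst x 'e_m (i == k)%:R))
  (dv_mul (dv_isqrt_sqn m 3 x0) (dv_mul (dv_coord x m i) (dv_coord x m k))))) _.
by rewrite /doseen; cbv beta; ring.
Qed.

Lemma derivable_doseen (x : vec) i k l m : 0 < sqn x ->
  derivable (doseen i k l) x 'e_m.
Proof.
move=> x0; have d3 := dv_isqrt_sqn m 3 x0; have d5 := dv_isqrt_sqn m 5 x0.
have c := dv_coord x m; have k0 := dv_cst x 'e_m.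
have := dv_mul (k0 ((8 * pi)^-1)) (dv_add
  (dv_opp (dv_mul (dv_mul (c l) d3) (k0 (i == k)%:R)))
  (dv_sub (dv_mul d3 (dv_add (dv_mul (k0 (i == l)%:R) (c k))
                             (dv_mul (c i) (k0 (k == l)%:R))))
     (dv_mul (dv_mul (dv_mul (k0 3) (c l)) d5) (dv_mul (c i) (c k))))).
by move/(@ex_derive _ _ _ _ _ _ _).
Qed.

Section smooth_dipole.
Variable eps : R.
Hypothesis eps0 : 0 < eps.

Lemma sqn_gt0 (x : vec) : eps ^+ 2 <= sqn x -> 0 < sqn x.
Proof. by apply: lt_le_trans; rewrite exprn_gt0. Qed.

(** The contraction also produces a multiple of [x_k] times the trace of [A], which vanishes. *)
Lemma vel_doseen (A : mat) (x : vec) k : \tr A = 0 -> eps ^+ 2 <= sqn x ->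
  \sum_l \sum_m A l m * doseen k l m x = vel (smooth_coef eps) A x k.
Proof.
rewrite trE => trA xe; rewrite /vel /= /piece ltNge xe /= !sum3E /doseen.
move: (isqrt (sqn x)) => s.
transitivity ((8 * pi)^-1 * (-1 * s ^+ 3 * apx A x k + 1 * s ^+ 3 * aptx A x k
  + -3 * s ^+ 5 * (x 0 k * qform A x))
  + (8 * pi)^-1 * s ^+ 3 * x 0 k * (A o0 o0 + A o1 o1 + A o2 o2)).
  by elim/ord3_ind: k; rewrite /= /qform /apx /aptx; ring.
by rewrite trA mulr0 addr0.
Qed.

Lemma dipole_vel (A : mat) (x : vec) k : \tr A = 0 -> eps ^+ 2 <= sqn x ->
  dipole A x 0 k = vel (smooth_coef eps) A x k.
Proof.
move=> trA xe; rewrite -vel_doseen// mxE; apply: eq_bigr => l _.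
apply: eq_bigr => m _; congr (_ * _).
exact: pdE (dv_oseen k l m (sqn_gt0 xe)).
Qed.

Lemma dipole_pressure_pre (A : mat) (x : vec) : \tr A = 0 -> eps ^+ 2 <= sqn x ->
  dipole_pressure A x = pre (smooth_coef eps) A x.
Proof.
rewrite trE => trA xe; have x0 := sqn_gt0 xe.
have dP l m : pd m (fun y : vec => oseen_pressure y 0 l) x =
    (4 * pi)^-1 * (isqrt (sqn x) ^+ 3 * (l == m)%:R
                   - 3 * x 0 m * isqrt (sqn x) ^+ 5 * x 0 l).
  rewrite (_ : (fun y : vec => oseen_pressure y 0 l) =
      fun y : vec => (4 * pi)^-1 * (isqrt (sqn y) ^+ 3 * y 0 l)); last first.
    by apply/funext => y; rewrite !mxE enormE /isqrt exprVn.
  apply: pdE; apply: dv_eq (dv_mul (dv_cst x 'e_m ((4 * pi)^-1))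
     (dv_mul (dv_isqrt_sqn m 3 x0) (dv_coord x m l))) _.
  by cbv beta; ring.
rewrite /dipole_pressure /pre /= /piece ltNge xe /= !sum3E !dP /=.
move: (isqrt (sqn x)) => s.
have -> : (4 * pi)^-1 = 2 * (8 * pi)^-1 :> R.
  have := @pi_gt0 R; move: (pi : R) => p p0.
  by field; rewrite gt_eqF.
transitivity ((8 * pi)^-1 * (-6 * s ^+ 5 * qform A x)
  + 2 * (8 * pi)^-1 * s ^+ 3 * (A o0 o0 + A o1 o1 + A o2 o2)).
  by rewrite /qform /apx; ring.
by rewrite trA mulr0 addr0.
Qed.

(** The contraction of [d_j d_l G_ik] with [B_kl] is the [j]-th derivative of the [i]-th component
    of the dipole field of [B]. *)
Lemma hess_oseen_gvel (B : mat) (x : vec) i j : \tr B = 0 -> eps ^+ 2 < sqn x ->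
  hess_oseen x B i j = gvel (smooth_coef eps) B x i j.
Proof.
move=> trB xe; have x0 := sqn_gt0 (ltW xe).
have xne : sqn x != eps ^+ 2 by rewrite gt_eqF.
have nx : \forall y \near x, eps ^+ 2 < sqn y.
  exact: near_sqn_gt.
have dg := dv_vel (regular_smooth eps0 xne) B i j.
rewrite -(pdE dg).
transitivity ('D_('e_j) (fun y => \sum_k \sum_l B k l * doseen i k l y) x);
    last first.
  by apply: near_eq_derive; apply: filterS nx => y ye; rewrite vel_doseen// ltW.
have E k l : pd j (pd l (fun y : vec => oseen y i k)) x = 'D_('e_j) (doseen i k l) x.
  apply: near_eq_derive; apply: filterS nx => y ye.
  exact: pdE (dv_oseen i k l (sqn_gt0 (ltW ye))).
have dk k l : is_derive x 'e_j (fun y => B k l * doseen i k l y)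
    (B k l * 'D_('e_j) (doseen i k l) x).
  have h : derivable (doseen i k l) x 'e_j by exact: derivable_doseen.
  apply: dv_eq (dv_mul (dv_cst x 'e_j (B k l)) (derivableP h)) _.
  by rewrite mulr0 addr0.
apply/esym/(etrans (pdE (dv_sum (index_enum _) (fun k =>
  dv_sum (index_enum _) (dk k))))); rewrite mxE.
by apply: eq_bigr => k _; apply: eq_bigr => l _; rewrite E mulrC.
Qed.

End smooth_dipole.

(** * Properties of the regularized dipole field used for integration by parts *)

Section kinematics.
Variables (eta : R) (A : mat) (u : vec -> vec).
Hypothesis eta0 : 0 < eta.

(** In the ball [rho] is bounded below by [(1 + r)^(-1/2)], so any bound there is absorbed into the
    constant. *)
Lemma decays_inside (L : seq (vec * R)) (n : nat) (r C : R) (f g : vec -> R) :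
  0 <= r -> (forall x, off L x -> {for x, continuous f}) ->
  (forall x, off L x -> sqn x < r -> `|f x| <= C) ->
  (forall x, off L x -> r <= sqn x -> f x = g x) ->
  decays L n g -> decays L n f.
Proof.
move=> r0 cf fC fg [_ [D gD]]; split=> //.
have s0 : 0 < Num.sqrt (1 + r) by rewrite sqrtr_gt0 ltr_pwDl.
exists (`|C| * Num.sqrt (1 + r) ^+ n + `|D|) => x ox; rewrite mulrDl.
have rn : 0 <= rho x ^+ n by rewrite exprn_ge0// ltW// rho_gt0.
have [xr|xr] := ltP (sqn x) r; last first.
  rewrite (fg _ ox xr) (le_trans (gD _ ox))// -[leLHS]add0r lerD//.
    by rewrite !mulr_ge0// exprn_ge0// ltW.
  by rewrite ler_wpM2r// ler_norm.
rewrite (le_trans (fC _ ox xr))// -[leLHS]addr0 lerD//; last exact: mulr_ge0.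
rewrite (le_trans (ler_norm _))// -mulrA -exprMn ler_peMr//.
rewrite exprn_ege1// ler_pdivlMr ?sqrtr_gt0 ?ltr_pwDl ?sqn_ge0// mul1r.
by rewrite ler_wsqrtr// lerD2l ltW.
Qed.

Lemma closure_eball : closure (@eball R eta) `<=` [set x | sqn x <= eta ^+ 2].
Proof.
have cS : closed [set x : vec | sqn x <= eta ^+ 2].
  apply: (@closed_comp _ _ (@sqn R) [set t | t <= eta ^+ 2]).
    by move=> x _; exact: continuous_sqn.
  exact: closed_le.
move/closure_id : cS => ->; apply: closureS => y.
by rewrite /eball /= enorm_lt ?(ltW eta0)//; exact: ltW.
Qed.

Lemma compact_closed_eball : compact (closure (@eball R eta)).
Proof.
apply: (@subclosed_compact _ _ [set v : vec | forall i, `[- eta, eta]%classic (v ord0 i)]).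
- exact: closed_closure.
- by apply: (@rV_compact R 3 (fun=> `[- eta, eta]%classic)) => i; exact: segment_compact.
- move=> x /closure_eball /= xe i; rewrite in_itv/= -ler_norml.
  rewrite -(@ler_pXn2r _ 2) ?nnegrE ?(ltW eta0)// real_normK ?num_real//.
  exact: le_trans (sqr_coord_le x i) xe.
Qed.

Lemma bounded_closure_eball (g : vec -> R) : {within closure (eball eta), continuous g} ->
  exists C, forall x, sqn x < eta ^+ 2 -> `|g x| <= C.
Proof.
move=> cg; have /compact_bounded[M [_ hM]] := continuous_compact cg compact_closed_eball.
exists (M + 1) => x xe; apply: (hM (M + 1)); first by rewrite ltrDl.
by exists x => //; apply: subset_closure; rewrite /eball /= enorm_lt ?ltW.
Qed.

Lemma open_eball : open (@eball R eta).
Proof.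
rewrite (_ : eball eta = @sqn R @^-1` [set t | t < eta ^+ 2]).
  by apply: open_comp; [move=> x _; exact: continuous_sqn|exact: open_lt].
by apply/predeqP => x; rewrite /eball /= enorm_lt ?ltW.
Qed.

Lemma eballP (x : vec) : eball eta x <-> sqn x < eta ^+ 2.
Proof. by rewrite /eball /= enorm_lt ?ltW. Qed.

(** Interface to a field that is selected by [get] and has no formula inside the ball. No continuity
    of the gradient is asserted on the sphere itself. *)
Definition kinematic (u : vec -> vec) : Prop :=
  [/\ forall x k, eta ^+ 2 <= sqn x -> u x 0 k = vel (smooth_coef eta) A x k,
      forall k, continuous (fun x => u x 0 k),
      forall x k m, sqn x < eta ^+ 2 -> derivable (fun y => u y 0 k) x 'e_m /\
        {for x, continuous (fun y => grad u y k m)},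
      forall k m, exists C, forall x, sqn x < eta ^+ 2 -> `|grad u x k m| <= C
    & forall x, sqn x < eta ^+ 2 -> \sum_k grad u x k k = 0].

Lemma gradE (w : vec -> vec) x k m : grad w x k m = pd m (fun y => w y 0 k) x.
Proof. by rewrite mxE. Qed.

(** Regularity up to the boundary bounds the gradient: each first derivative extends continuously to
    the closed ball, which is compact. *)
Lemma regularization_kinematic p : \tr A = 0 -> is_regularization eta A u p ->
  kinematic u.
Proof.
move=> trA [hext hc hC2 _ hst]; split.
- move=> x k xe; have xe' : eta <= enorm x by rewrite enorm_ge// ltW.
  by rewrite (hext x xe').1 (dipole_vel eta0).
- move=> k x; apply: (@continuous_comp _ _ _ u (fun v : vec => v 0 k)).
    exact: hc.
  exact: continuous_coord.
- move=> x k m /eballP xe; have [_ /(_ m)[dm [[g [cg gE]] _]]] := hC2 k.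
  split; first exact: dm.
  have nE : \forall y \near x, g y = grad u y k m.
    have : nbhs x (eball eta) by apply: open_nbhs_nbhs; split => //; exact: open_eball.
    by apply: filterS => y ye; rewrite gE// gradE.
  have cgx : {for x, continuous g}.
    have := continuous_subspaceW (@subset_closure _ (eball eta)) cg.
    rewrite (continuous_open_subspace g open_eball) => /(_ x); apply.
    by rewrite inE.
  change (grad u y k m @[y --> x] --> grad u x k m).
  rewrite gradE -gE//; exact: cvg_trans (near_eq_cvg nE) cgx.
- move=> k m; have [_ /(_ m)[dm [[g [cg gE]] _]]] := hC2 k.
  have [C hC] := bounded_closure_eball cg; exists C => x xe.
  by rewrite gradE -gE ?hC//; exact/eballP.
- move=> x /eballP/hst[_ d0]; rewrite -[RHS]d0.
  by apply: eq_bigr => k _; rewrite gradE.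
Qed.

Section consequences.
Hypotheses (trA : \tr A = 0) (ku : kinematic u).

Lemma off1E (x : vec) (r : R) : off [:: (0, r)] x = (sqn x != r).
Proof. by rewrite /off /= subr0 andbT. Qed.

Lemma grad_ext x k m : eta ^+ 2 < sqn x ->
  is_derive x 'e_m (fun y => u y 0 k) (gvel (smooth_coef eta) A x k m).
Proof.
move=> xe; have [ue _ _ _ _] := ku.
apply: (@near_eq_is_derive _ _ _ (fun y => vel (smooth_coef eta) A y k)).
  apply: filterS (near_sqn_gt xe) => y /= ye.
  by rewrite ue// ltW.
by apply: dv_vel; apply: regular_smooth => //; rewrite gt_eqF.
Qed.

Lemma grad_extE x k m : eta ^+ 2 < sqn x ->
  grad u x k m = gvel (smooth_coef eta) A x k m.
Proof. by move=> xe; rewrite gradE; exact/pdE/grad_ext. Qed.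

Lemma dv_kinematic x k m : sqn x != eta ^+ 2 ->
  is_derive x 'e_m (fun y => u y 0 k) (grad u x k m).
Proof.
have [_ _ ud _ _] := ku.
rewrite neq_lt => /orP[xe|xe]; last by rewrite grad_extE//; exact: grad_ext.
by rewrite gradE; apply: derivableP; have [] := ud x k m xe.
Qed.

Lemma decays_kinematic k : decays [::] 2 (fun x => u x 0 k).
Proof.
have [ue uc _ _ _] := ku.
have [C hC] : exists C, forall x, sqn x < eta ^+ 2 -> `|u x 0 k| <= C.
  by apply: bounded_closure_eball; exact/continuous_subspaceT/uc.
apply: (@decays_inside _ 2 (eta ^+ 2) C _ (fun x => vel (smooth_coef eta) A x k)).
- exact: sqr_ge0.
- by move=> x _; exact: uc.
- by move=> x _; exact: hC.
- by move=> x _; exact: ue.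
- exact: decays_vel.
Qed.

Lemma decays_grad k m : decays [:: (0, eta ^+ 2)] 3 (fun x => grad u x k m).
Proof.
have [_ _ ud ub _] := ku; have [C hC] := ub k m.
have [cg _] := decays_gvel eta0 [::] A k m.
apply: (@decays_inside _ 3 (eta ^+ 2) C _ (fun x => gvel (smooth_coef eta) A x k m)).
- exact: sqr_ge0.
- move=> x; rewrite off1E neq_lt => /orP[xe|xe].
    by have [] := ud x k m xe.
  change (grad u y k m @[y --> x] --> grad u x k m).
  have nE : \forall y \near x, gvel (smooth_coef eta) A y k m = grad u y k m.
    by apply: filterS (near_sqn_gt xe) => y /= ye; rewrite grad_extE.
  rewrite grad_extE//; exact: cvg_trans (near_eq_cvg nE) (cg x isT).
- by move=> x _; exact: hC.
- move=> x; rewrite off1E => xo xe; apply: grad_extE.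
  by rewrite lt_neqAle eq_sym xo xe.
- exact: decays_gvel.
Qed.

Lemma tr_grad x : sqn x != eta ^+ 2 -> \sum_k grad u x k k = 0.
Proof.
rewrite neq_lt => /orP[xe|xe]; first by have [_ _ _ _ ->] := ku.
have xn : sqn x != eta ^+ 2 by rewrite gt_eqF.
rewrite -[RHS](div_gvel (stokes_smooth eta0 (sqn_ge0 x)) trA).
by apply: eq_bigr => k _; rewrite grad_extE.
Qed.

End consequences.

End kinematics.

(** * Polynomial functions are smooth up to the boundary *)

Section polynomials.
Implicit Types (f g : vec -> R).

(** A class of globally continuous functions that is closed under partial derivatives, so that
    [Ck_closure] follows by induction on the order. *)
Inductive polyfun : (vec -> R) -> Prop :=
| PolyCst c : polyfun (fun=> c)
| PolyCoord k : polyfun (fun x => x 0 k)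
| PolyAdd f g : polyfun f -> polyfun g -> polyfun (fun x => f x + g x)
| PolyMul f g : polyfun f -> polyfun g -> polyfun (fun x => f x * g x).

Lemma polyfun_continuous f : polyfun f -> continuous f.
Proof.
elim=> [c|k|{}f g _ cf _ cg|{}f g _ cf _ cg] x.
- exact: cst_continuous.
- exact: continuous_coord.
- by apply: cont_add; [exact: cf|exact: cg].
- by apply: cont_mul; [exact: cf|exact: cg].
Qed.

Lemma polyfun_derive f m : polyfun f ->
  exists2 g, polyfun g & forall x, is_derive x 'e_m f (g x).
Proof.
elim=> [c|k|{}f g _ [f' pf' df] _ [g' pg' dg]|{}f g pf [f' pf' df] pg [g' pg' dg]].
- by exists (fun=> 0); [exact: PolyCst|move=> x; exact: dv_cst].
- by exists (fun=> (k == m)%:R); [exact: PolyCst|move=> x; exact: dv_coord].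
- by exists (fun x => f' x + g' x); [exact: PolyAdd|move=> x; exact: dv_add].
- exists (fun x => f x * g' x + g x * f' x).
    by apply: PolyAdd; exact: PolyMul.
  by move=> x; exact: dv_mul.
Qed.

Lemma Ck_closure_poly k (U : set vec) f g : open U -> polyfun g ->
  (forall x, U x -> f x = g x) -> Ck_closure k U f.
Proof.
move=> oU; elim: k f g => [|k IH] f g pg fg /=; split.
- by exists g; split; [exact/continuous_subspaceT/polyfun_continuous|
    move=> x Ux; rewrite fg].
- by [].
- by exists g; split; [exact/continuous_subspaceT/polyfun_continuous|
    move=> x Ux; rewrite fg].
move=> m; have [g' pg' dg] := polyfun_derive m pg.
have df x : U x -> is_derive x 'e_m f (g' x).
  move=> Ux; apply: near_eq_is_derive (dg x).
  have nU : nbhs x U by exact: open_nbhs_nbhs.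
  by apply: filterS nU => y Uy; rewrite fg.
split; first by move=> x /df [].
by apply: IH pg' _ => x /df/pdE.
Qed.

End polynomials.

(** * Existence of the regularized dipole *)

Section existence.
Variables (eta : R) (A : mat).
Hypotheses (eta0 : 0 < eta) (trA : \tr A = 0).

Let cf := interior_coef eta.

Lemma polyfun_sqn : polyfun (@sqn R).
Proof.
rewrite (_ : @sqn R = fun x => x 0 o0 * x 0 o0 + x 0 o1 * x 0 o1 + x 0 o2 * x 0 o2).
  by do 2?[apply: PolyAdd]; apply: PolyMul; exact: PolyCoord.
by apply/funext => y; rewrite /sqn sum3E !expr2.
Qed.

Lemma polyfun_apx k : polyfun (fun x => apx A x k).
Proof.
have p l : polyfun (fun x => A k l * x 0 l).
  exact: PolyMul (PolyCst _) (PolyCoord _).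
exact: PolyAdd (PolyAdd (p _) (p _)) (p _).
Qed.

Lemma polyfun_aptx k : polyfun (fun x => aptx A x k).
Proof.
have p l : polyfun (fun x => A l k * x 0 l).
  exact: PolyMul (PolyCst _) (PolyCoord _).
exact: PolyAdd (PolyAdd (p _) (p _)) (p _).
Qed.

Lemma polyfun_qform : polyfun (qform A).
Proof.
have p l : polyfun (fun x => x 0 l * apx A x l).
  exact: PolyMul (PolyCoord _) (polyfun_apx _).
exact: PolyAdd (PolyAdd (p _) (p _)) (p _).
Qed.

Lemma polyfun_piece k c0 c1 c2 g : exists2 f, polyfun f &
  forall x, sqn x < eta ^+ 2 -> piece eta k c0 c1 c2 g (sqn x) = f x.
Proof.
pose T x := sqn x * (eta ^+ 2)^-1 + - 1.
have pT : polyfun T.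
  by apply: PolyAdd (PolyCst _); apply: PolyMul (PolyCst _); exact: polyfun_sqn.
exists (fun x => eta^-1 ^+ k * (c0 + c1 * T x + c2 * (T x * T x))).
  apply: PolyMul (PolyCst _) _; apply: PolyAdd; last first.
    by apply: PolyMul (PolyCst _) _; exact: PolyMul.
  by apply: PolyAdd (PolyCst _) _; exact: PolyMul (PolyCst _) pT.
by move=> x xe; rewrite /piece xe expr2.
Qed.

(** Without a witness, [get] in [reg_dipole] would return an arbitrary field; [interior_coef]
    supplies one. *)
Lemma regularization_exists : exists u p, is_regularization eta A u p.
Proof.
exists (fun x => \row_k vel cf A x k), (pre cf A).
have vE k : (fun x => (\row_k vel cf A x k) 0 k) = (fun x => vel cf A x k).
  by apply/funext => x; rewrite mxE.
have ballE x : eball eta x -> sqn x < eta ^+ 2 by rewrite /eball /= enorm_lt ?ltW.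
have ne x : sqn x < eta ^+ 2 -> sqn x != eta ^+ 2 by move=> h; rewrite lt_eqF.
split.
- move=> x; rewrite enorm_ge ?(ltW eta0)// => xe; split.
    apply/rowP => k; rewrite (dipole_vel eta0)// mxE.
    by rewrite /vel /= /piece ltNge xe.
  by rewrite (dipole_pressure_pre eta0)// /pre /= /piece ltNge xe.
- have cv k : continuous (fun x => vel cf A x k).
    have dp := @decays_piece R eta eta0 [::].
    (* For the empty list, [decays] contains continuity everywhere. *)
    have [] : decays [::] 2 (fun x => vel cf A x k); last by move=> h _ x; exact: h.
    apply: decays_scale; apply: (@decays_add _ _ 2); first apply: (@decays_add _ _ 2).
    + exact: decays_mul (dp 3 (-1) _ _ (-1) (or_intror erefl)) (decays_apx _ A k).
    + exact: decays_mul (dp 3 1 _ _ 1 (or_intror erefl)) (decays_aptx _ A k).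
    + exact: decays_mul (dp 5 (-3) _ _ (-3) (or_intror erefl))
        (decays_mul (decays_coord _ k) (decays_qform _ A)).
  rewrite (_ : (fun x => _) = fun x => vel cf A x o0 *: 'e_o0
      + vel cf A x o1 *: 'e_o1 + vel cf A x o2 *: 'e_o2); last first.
    apply/funext => x; apply/rowP => k; rewrite !mxE /=.
    by elim/ord3_ind: k; rewrite /= ?mulr1 ?mulr0 ?addr0 ?add0r.
  have cz k (v : vec) : continuous (fun x => vel cf A x k *: v).
    by move=> x; exact: continuousZr_tmp (cv k x).
  by move=> x; exact: cvgD (cvgD (cz _ _ x) (cz _ _ x)) (cz _ _ x).
- move=> k; rewrite vE.
  have [fa pa ea] := polyfun_piece 3 (-1) (15 / 4) 0 (-1).
  have [fb pb eb] := polyfun_piece 3 1 (15 / 4) 0 1.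
  have [fc pc ec] := polyfun_piece 5 (-3) 0 0 (-3).
  apply: (@Ck_closure_poly _ _ _ (fun x => (8 * pi)^-1 * (fa x * apx A x k
     + fb x * aptx A x k + fc x * (x 0 k * qform A x)))).
  + exact: open_eball.
  + apply: PolyMul (PolyCst _) (PolyAdd (PolyAdd (PolyMul pa (polyfun_apx k))
      (PolyMul pb (polyfun_aptx k))) (PolyMul pc (PolyMul (PolyCoord k) polyfun_qform))).
  + by move=> x /ballE xe; rewrite /vel /= ea// eb// ec.
- have [fd pd ed] := polyfun_piece 5 (63 / 2) 0 0 (-6).
  apply: (@Ck_closure_poly _ _ _ (fun x => (8 * pi)^-1 * (fd x * qform A x))).
  + exact: open_eball.
  + exact: PolyMul (PolyCst _) (PolyMul pd polyfun_qform).
  + by move=> x /ballE xe; rewrite /pre /= ed.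
- move=> x /ballE xe; have reg := regular_interior eta0 (ne _ xe).
  have st := stokes_interior eta0 (sqn_ge0 x).
  split; last first.
    rewrite /div -[RHS](div_gvel st trA); apply: eq_bigr => k _.
    by rewrite vE; exact/pdE/dv_vel.
  move=> k; rewrite /laplacian (pdE (dv_pre reg A k)) vE.
  have hE m : pd m (pd m (fun y => vel cf A y k)) x = hvel cf A x k m.
    apply: pdE; apply: near_eq_is_derive (dv_gvel reg A k m).
    apply: filterS (near_sqn_lt xe) => y ye; apply/esym/pdE/dv_vel.
    exact/regular_interior/ne.
  under eq_bigr do rewrite hE.
  (* The blob coefficient of [interior_coef] is zero, so the vanishing divergence of the stress is
     the homogeneous momentum equation. *)
  have dE m : dstress cf A x k m = hvel cf A x k m - (k == m)%:R * dpre cf A x m.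
    by rewrite /dstress /dblob /= /piece xe !(mul0r, addr0, mulr0).
  have := div_dstress st k trA; rewrite -/cf (eq_bigr _ (fun m _ => dE m)).
  by rewrite !sum3E; elim/ord3_ind: k {vE hE dE} => /=; lra.
Qed.

End existence.

End dipole_fields.

(** * Volume of the ball by slicing, towards the mass of the blob *)

Section ball_volume.
Context {R : realType}.
Notation vec := 'rV[R]_3.
Notation mu := (@lebesgue_measure R).
Notation TR := (measurableTypeR R).

Lemma integral_supported (f F : R -> R) (a b : R) : a <= b -> continuous F ->
  continuous f -> (forall t, t <= a -> f t = 0) -> (forall t, b <= t -> f t = 0) ->
  (forall t, a < t < b -> is_derive t 1 F (f t)) ->
  (\int[mu]_t (f t)%:E = (F b - F a)%:E)%E.
Proof.
move=> ab cF cf fa fb dF.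
have int_f : mu.-integrable `[a, b] (EFin \o f).
  apply: continuous_compact_integrable; first exact: segment_compact.
  exact: continuous_subspaceT.
rewrite -(@ftc_open _ f F a b ab cF)//; last first.
  by move=> t tab; split; [exact: dF|exact: cf].
rewrite /Rintegral fineK; last by apply: integrable_fin_num.
rewrite [RHS]integral_mkcond; apply: eq_integral => t _.
rewrite patchE; case: ifPn => // /negP; rewrite inE /= in_itv/= => /negP.
rewrite negb_and -!ltNge => /orP[ta|tb]; first by rewrite fa// ltW.
by rewrite fb// ltW.
Qed.

(** For [s < 0] the chord is empty, in agreement with the default [Num.sqrt s = 0]. *)
Lemma integral_chord (s a : R) :
  (\int[mu]_t (if (t - a) ^+ 2 < s then 1 else 0)%:E = (2 * Num.sqrt s)%:E)%E.
Proof.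
set m := Num.sqrt s.
have -> : (fun t => (if (t - a) ^+ 2 < s then 1 else 0)%:E) =
    (fun t => (\1_(`]a - m, a + m[%classic) t)%:E) :> (R -> \bar R).
  apply/funext => t; rewrite indicE; congr (_%:E).
  have -> : (t \in `]a - m, a + m[%classic) = ((t - a) ^+ 2 < s).
    rewrite mem_setE in_itv/=.
    have -> : (a - m < t < a + m) = (`|t - a| < m).
      by rewrite ltr_norml; apply/andP/andP => -[? ?]; split; lra.
    rewrite -sqrtr_sqr; have [s0|s0] := ltP 0 s; first by rewrite ltr_sqrt.
    rewrite /m (ler0_sqrtr s0) ltNge sqrtr_ge0/=; apply/esym/negbTE.
    by rewrite -leNgt (le_trans s0)// sqr_ge0.
  by case: ifP.
rewrite integral_indic// setIT.
apply: (etrans (lebesgue_measure_itv (Interval (BRight (a - m)) (BLeft (a + m))))).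
rewrite /= lte_fin.
have m0 : 0 <= m by exact: sqrtr_ge0.
case: ifPn => h; first by rewrite -EFinD; congr (_%:E); ring.
by congr (_%:E); apply/eqP; rewrite eq_le; apply/andP; split; lra.
Qed.

Lemma dv1_comp (f g : R -> R) (t df dg : R) :
  is_derive t 1 f df -> is_derive (f t) 1 g dg ->
  is_derive t 1 (fun u => g (f u)) (df * dg).
Proof. by move=> hf hg; rewrite mulrC; exact: (@is_derive1_comp R g f t dg df). Qed.

Lemma continuous_sqrt_comp (f : R -> R) : continuous f ->
  continuous (fun t => Num.sqrt (f t)).
Proof.
by move=> cf t; apply: continuous_comp; [exact: cf|exact: sqrt_continuous].
Qed.

Lemma integral_disc (s a : R) :
  (\int[mu]_t (2 * Num.sqrt (s - (t - a) ^+ 2))%:E = (pi * Num.max 0 s)%:E)%E.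
Proof.
have [s0|s0] := leP s 0.
  rewrite mulr0; apply: integral0_eq => t _.
  by rewrite ler0_sqrtr ?mulr0// subr_le0 (le_trans s0)// sqr_ge0.
set m := Num.sqrt s.
have m0 : 0 < m by rewrite sqrtr_gt0.
have m2 : m ^+ 2 = s by rewrite sqr_sqrtr// ltW.
pose w t := Num.sqrt (s - (t - a) ^+ 2).
(* The [atan] term is half of [asin ((t - a) / m)]. In this form [F] is continuous up to the
   endpoints, where [w] vanishes and [atan] equals [pi / 4] up to sign. *)
pose F t := (t - a) * w t + 2 * s * atan ((t - a) / (m + w t)).
have w0 t : 0 <= w t by exact: sqrtr_ge0.
have mw t : m + w t != 0 by rewrite gt_eqF// ltr_pwDl.
have csub : continuous (fun t : R => t - a).
  move=> t; exact: (@continuousB R R R id (cst a) t cvg_id (@cst_continuous _ _ a t)).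
have cw : continuous w.
  apply: continuous_sqrt_comp => t.
  have c2 : {for t, continuous (fun u => (u - a) ^+ 2)}.
    exact: cont_mul (csub t) (csub t).
  exact: (@continuousB R R R (cst s) _ t (@cst_continuous _ _ s t) c2).
have cF : continuous F.
  move=> t.
  have c1 : {for t, continuous (fun u => m + w u)}.
    exact: cont_add (@cst_continuous _ _ m t) (cw t).
  have c2 : {for t, continuous (fun u => (m + w u)^-1)}.
    exact: (@continuousV _ _ (fun u => m + w u) t (mw t) c1).
  have c3 : {for t, continuous (fun u => atan ((u - a) / (m + w u)))}.
    apply: (@continuous_comp _ _ _ (fun u => (u - a) / (m + w u)) atan).
      exact: cont_mul (csub t) c2.
    exact: continuous_atan.
  exact: cont_add (cont_mul (csub t) (cw t))
    (cont_mul (@cst_continuous _ _ (2 * s) t) c3).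
have wa : w (a + m) = 0 by rewrite /w addrAC subrr add0r m2 subrr sqrtr0.
have wb : w (a - m) = 0 by rewrite /w addrAC subrr add0r sqrrN m2 subrr sqrtr0.
apply: (etrans (@integral_supported (fun t => 2 * w t) F (a - m) (a + m) _ _ _ _ _ _)).
- by lra.
- exact: cF.
- by move=> t; apply: (@cont_mul _ _ (cst 2) w t); [exact: cst_continuous|exact: cw].
- move=> t ta; rewrite /w ler0_sqrtr ?mulr0// subr_le0 -m2.
  rewrite -[(t - a) ^+ 2]sqrrN; apply: lerXn2r; rewrite ?nnegrE; lra.
- move=> t ta; rewrite /w ler0_sqrtr ?mulr0// subr_le0 -m2.
  by apply: lerXn2r; rewrite ?nnegrE; lra.
- move=> t /andP[ta tb].
  have wt : 0 < s - (t - a) ^+ 2.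
    by rewrite subr_gt0 -m2 -real_normK ?num_real// ltrXn2r// ltr_norml; lra.
  have wp : 0 < w t by rewrite sqrtr_gt0.
  have w2 : (t - a) ^+ 2 = m ^+ 2 - w t ^+ 2.
    by rewrite m2 /w sqr_sqrtr ?(ltW wt)//; ring.
  have dsub : is_derive t 1 (fun u : R => u - a) 1.
    by apply: dv_eq (dv_sub (is_derive_id t (1 : R)) (dv_cst t 1 a)) _; rewrite subr0.
  have dq : is_derive t 1 (fun u => s - (u - a) ^+ 2) (- 2 * (t - a)).
    apply: dv_eq (dv_sub (dv_cst t 1 s) (dv_mul dsub dsub)) _.
    by cbv beta; ring.
  have dw : is_derive t 1 w (- (t - a) / w t).
    apply: dv_eq (dv1_comp dq (is_derive1_sqrt wt)) _.
    by rewrite -/(w t); field; rewrite gt_eqF.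
  have dV : is_derive t 1 (fun u => (m + w u)^-1) ((t - a) / w t / (m + w t) ^+ 2).
    apply: dv_eq (@is_deriveV _ (fun u => m + w u) t _ 1 (mw t) (dv_add (dv_cst t 1 m) dw)) _.
    by rewrite /GRing.scale /=; field; rewrite mw gt_eqF.
  have dA := dv1_comp (dv_mul dsub dV) (is_derive1_atan ((t - a) / (m + w t))).
  apply: dv_eq (dv_add (dv_mul dsub dw) (dv_mul (dv_cst t 1 (2 * s)) dA)) _.
  cbv beta; set p := t - a in w2 *.
  have e1 : (1 + (p / (m + w t)) ^+ 2)^-1 = (m + w t) / (2 * m).
    have -> : (p / (m + w t)) ^+ 2 = (m ^+ 2 - w t ^+ 2) / (m + w t) ^+ 2.
      by rewrite -w2 expr_div_n.
    by rewrite (_ : 1 + _ = 2 * m / (m + w t)) ?invf_div//; field; exact: mw.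
  rewrite e1 -m2.
  have e2 : p * (- p / w t) = - (m ^+ 2 - w t ^+ 2) / w t.
    by rewrite -w2; field; rewrite gt_eqF.
  have e3 : p * (p / w t / (m + w t) ^+ 2) = (m - w t) / w t / (m + w t).
    transitivity (p ^+ 2 / w t / (m + w t) ^+ 2); first by rewrite !mulrA -expr2.
    by rewrite w2; field; rewrite mw gt_eqF.
  rewrite e2 e3; field.
  by rewrite mw !gt_eqF.
- congr (_%:E); rewrite /F wa wb !addr0 !mulr0 !add0r.
  have -> : (a + m - a) / m = 1 by rewrite addrAC subrr add0r divff// gt_eqF.
  have -> : (a - m - a) / m = - 1.
    by rewrite addrAC subrr add0r mulNr divff// gt_eqF.
  by rewrite atanN atan1; field.
Qed.

Lemma integral_max_disc (e a : R) : 0 < e ->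
  (\int[mu]_t (pi * Num.max 0 (e ^+ 2 - (t - a) ^+ 2))%:E =
   (4 / 3 * pi * e ^+ 3)%:E)%E.
Proof.
move=> e0.
pose q t := e ^+ 2 - (t - a) * (t - a).
pose F t := pi * (e ^+ 2 * (t - a) - 3^-1 * ((t - a) * ((t - a) * (t - a)))).
have csub : continuous (fun t : R => t - a).
  move=> t; exact: (@continuousB R R R id (cst a) t cvg_id (@cst_continuous _ _ a t)).
have cc (k : R) : continuous (fun _ : R => k) by move=> t; exact: cst_continuous.
have cq : continuous q.
  move=> t; exact: (@continuousB R R R (cst (e ^+ 2)) _ t (cc _ t)
    (cont_mul (csub t) (csub t))).
have dsub (t : R) : is_derive t 1 (fun u : R => u - a) 1.
  by apply: dv_eq (dv_sub (is_derive_id t (1 : R)) (dv_cst t 1 a)) _; rewrite subr0.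
have dF (t : R) : is_derive t 1 F (pi * q t).
  apply: dv_eq (dv_mul (dv_cst t 1 (pi : R)) (dv_sub (dv_mul (dv_cst t 1 (e ^+ 2)) (dsub t))
    (dv_mul (dv_cst t 1 (3^-1 : R)) (dv_mul (dsub t) (dv_mul (dsub t) (dsub t)))))) _.
  by cbv beta; rewrite /q; field.
have qout t : (e <= `|t - a|) -> q t <= 0.
  move=> h; rewrite /q subr_le0 -expr2 -[leRHS]real_normK ?num_real//.
  by rewrite ler_pXn2r ?nnegrE// ltW.
apply: (etrans (@integral_supported (fun t => pi * Num.max 0 (e ^+ 2 - (t - a) ^+ 2))
   F (a - e) (a + e) _ _ _ _ _ _)).
- by lra.
- move=> t; have := dF t => /(@ex_derive _ _ _ _ _ _ _).
  by move=> /derivable1_diffP /differentiable_continuous.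
- have -> : (fun t => pi * Num.max 0 (e ^+ 2 - (t - a) ^+ 2)) =
      (fun t => pi * (2^-1 * (q t + `|q t|))).
    apply/funext => t; rewrite /q -expr2; congr (_ * _).
    by case: leP => h; [rewrite ger0_norm|rewrite ltr0_norm]=> //; field.
  move=> t; have cn : {for t, continuous (fun t => `|q t|)}.
    by apply: (@continuous_comp _ _ _ q (fun u => `|u|)); [exact: cq|exact: norm_continuous].
  exact: cont_mul (cc _ t) (cont_mul (cc _ t) (cont_add (cq t) cn)).
- move=> t ta; rewrite max_l ?mulr0//; have := qout t; rewrite /q -expr2; apply.
  by rewrite ler0_norm; lra.
- move=> t ta; rewrite max_l ?mulr0//; have := qout t; rewrite /q -expr2; apply.
  by rewrite ger0_norm; lra.
- move=> t ta; apply: dv_eq (dF t) _; congr (_ * _).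
  rewrite max_r// /q -?expr2// subr_ge0 -[leLHS]real_normK ?num_real//.
  by rewrite ler_pXn2r ?nnegrE// ?(ltW e0)// ler_norml; lra.
- by congr (_%:E); rewrite /F; field.
Qed.

Lemma integral3_ball (c : 'rV[R]_3) (e : R) : 0 < e ->
  integral3 (fun x => if sqn (x - c) < e ^+ 2 then 1 else 0) =
  (4 / 3 * pi * e ^+ 3)%:E.
Proof.
move=> e0; rewrite -(integral_max_disc (c 0 o0) e0).
pose f (z : TR * TR * TR) : R := if sqn (V3 z - c) < e ^+ 2 then 1 else 0.
have mf : measurable_fun setT f.
  have oU : open [set x : 'rV[R]_3 | sqn (x - c) < e ^+ 2].
    rewrite [X in open X](_ : _ = (fun x => sqn (x - c)) @^-1` [set t | t < e ^+ 2]).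
      apply: open_comp => [x _|]; last exact: open_lt.
      apply: continuous_comp; last exact: continuous_sqn.
      exact: continuous_subr.
    by [].
  have := measurable_indic (open_preimage_measurable oU) => h.
  rewrite (_ : f = \1_(V3 @^-1` [set x : 'rV[R]_3 | sqn (x - c) < e ^+ 2])); first exact: h.
  apply/funext => z; rewrite indicE /f.
  by case: ifPn => [h1|/negP h1]; [rewrite mem_set|rewrite memNset].
have sE z : sqn (V3 z - c) =
    (z.1.1 - c 0 o0) ^+ 2 + (z.1.2 - c 0 o1) ^+ 2 + (z.2 - c 0 o2) ^+ 2.
  by rewrite /sqn sum3E !mxE.
transitivity (\int[leb2 \x mu]_z (f z)%:E)%E; first by [].
rewrite fubini_tonelli1 /fubini_F/=; first last.
- by move=> z; rewrite lee_fin /f; case: ifP.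
- exact/measurable_EFinP.
pose g (p : TR * TR) : R :=
  2 * Num.sqrt (e ^+ 2 - (p.1 - c 0 o0) ^+ 2 - (p.2 - c 0 o1) ^+ 2).
have mg : measurable_fun setT g.
  have msq (k : R) : measurable_fun setT (fun u : TR => (u - k) ^+ 2).
    by apply: measurable_funX; apply: measurable_funB => //; exact: measurable_cst.
  apply: measurable_funM; first exact: measurable_cst.
  apply: (measurableT_comp (continuous_measurable_fun (@sqrt_continuous R))).
  apply: measurable_funB; first apply: measurable_funB.
  - exact: measurable_cst.
  - exact: measurableT_comp (msq _) measurable_fst.
  - exact: measurableT_comp (msq _) measurable_snd.
transitivity (\int[leb2]_p (g p)%:E)%E.
  apply: eq_integral => p _; rewrite /g -(integral_chord _ (c 0 o2)).
  apply: eq_integral => t _; rewrite /f sE /=; congr (_%:E).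
  rewrite (_ : (_ < e ^+ 2) = ((t - c 0 o2) ^+ 2 <
    e ^+ 2 - (p.1 - c 0 o0) ^+ 2 - (p.2 - c 0 o1) ^+ 2))//.
  by apply/idP/idP => ?; lra.
transitivity (\int[mu \x mu]_p (g p)%:E)%E; first by [].
rewrite fubini_tonelli1 /fubini_F/=; first last.
- by move=> z; rewrite lee_fin mulr_ge0// sqrtr_ge0.
- exact/measurable_EFinP.
by apply: eq_integral => t _; rewrite -(integral_disc _ (c 0 o1)).
Qed.

Lemma dv_shift (V W : normedModType R) (c x v : V) (f : V -> W) (df : W) :
  is_derive (x - c) v f df -> is_derive x v (fun y => f (y - c)) df.
Proof.
have E : (fun h : R => h^-1 *: (((fun y => f (y - c)) \o shift x) (h *: v) - f (x - c))) =
  (fun h : R => h^-1 *: ((f \o shift (x - c)) (h *: v) - f (x - c))).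
  by apply/funext => h; rewrite /= /shift addrA.
by move=> [d1 d2]; split; rewrite /derivable /derive E.
Qed.

Lemma decays_shift_sphere (n : nat) (c : 'rV[R]_3) (s : R) (L : seq ('rV[R]_3 * R)) f :
  (c, s) \in L -> decays [:: (0, s)] n f -> decays L n (fun x => f (x - c)).
Proof.
move=> cL; apply: decays_shift => x /allP /(_ _ cL) /= h.
by rewrite /off /= subr0 h.
Qed.

(** * The blob: unit mass, L^1 bound, concentration *)

Section mass.
Variables (e : R) (c : 'rV[R]_3) (L : seq ('rV[R]_3 * R)).
Hypotheses (e0 : 0 < e) (cL : (c, e ^+ 2) \in L).

Let P k c0 c1 c2 (x : 'rV[R]_3) := piece e k c0 c1 c2 0 (sqn x).

Lemma decays_bump (k : nat) c0 c1 c2 : decays L k (fun x => P k c0 c1 c2 (x - c)).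
Proof.
apply: (@decays_shift_sphere k c _ L (P k c0 c1 c2) cL).
by apply: decays_piece => //; left; rewrite inE eqxx.
Qed.

(** The indicator is a constant [piece] of exponent 6 with inner coefficient [e ^ 6] and outer
    branch 0. *)
Lemma decays_ball : decays L 6 (fun x => if sqn (x - c) < e ^+ 2 then 1 else 0 : R).
Proof.
apply: decays_ext (decays_bump 6 (e ^+ 6) 0 0) => x _.
rewrite /P /piece; case: ifP => _; last by rewrite mul0r.
by rewrite !mul0r !addr0 exprVn mulVf// expf_neq0// gt_eqF.
Qed.

Lemma J_ball : J L (fun x => if sqn (x - c) < e ^+ 2 then 1 else 0) = 4 / 3 * pi * e ^+ 3.
Proof.
apply: EFin_inj; rewrite -(integral3_ball c e0) -(integral_cut decays_ball).
by rewrite -(integral3_cut (proj1 decays_ball) (fun x _ => erefl)).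
Qed.

(* [blob - 6 (8 pi)^-1 e^-3 1_ball] is the divergence of
   [y e^-3 (135/8 tau^2 - 3 tau) / (8 pi)], which vanishes on the sphere. *)
Lemma J_blob : J L (fun x => blob (smooth_coef e) (x - c)) = 1.
Proof.
have e1 : e != 0 by rewrite gt_eqF.
have pi0 : pi != 0 :> R by rewrite gt_eqF// pi_gt0.
(* The exponent 7 in place of 3 is padding: the field vanishes outside the ball, and the higher
   power supplies decay of order 6. The factor [e ^ 4] in [K] undoes it. *)
pose F m (x : 'rV[R]_3) := x 0 m * P 7 0 (-3) (135 / 8) x.
pose D m (x : 'rV[R]_3) := P 7 0 (-3) (135 / 8) x + 2 * (x 0 m ^+ 2 * P 9 (-3) (135 / 4) 0 x).
have dF m x : sqn x != e ^+ 2 -> is_derive x 'e_m (F m) (D m x).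
  move=> xe; have := dv_mul (dv_coord x m m) (dv_comp (dv_sqn x m)
    (is_derive_piece e0 7 0 (-3) (135 / 8) 0 xe)).
  move=> h; apply: dv_eq h _.
  have -> : (m == m)%:R = 1 :> R by rewrite eqxx.
  have -> : 2 * (135 / 8) = 135 / 4 :> R by field.
  by cbv beta; rewrite /D /P mulr0; ring.
have dD m : decays L 6 (fun x => D m (x - c)).
  apply: (@decays_shift_sphere 6 c _ L (D m) cL).
  have d (k : nat) c0 c1 c2 : decays [:: (0, e ^+ 2)] k (P k c0 c1 c2).
    by apply: decays_piece => //; left; rewrite inE eqxx.
  have h7 : decays [:: (0, e ^+ 2)] 6 (P 7 0 (-3) (135 / 8)).
    by apply: decays_le (d 7 _ _ _).
  have h9 : decays [:: (0, e ^+ 2)] 6 (fun x => x 0 m ^+ 2 * P 9 (-3) (135 / 4) 0 x).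
    by apply: decays_le (decays_mul (decays_coord2 _ m) (d 9 (-3) (135 / 4) 0)).
  exact: decays_add h7 (decays_scale 2 h9).
have JD m : J L (fun x => D m (x - c)) = 0.
  have d0 : decays [::] 1 (fun x => F m (x - c)).
    apply: (@decays_shift R [::] [::] 1 c (F m)) => //.
    have p7 : decays [::] 7 (P 7 0 (-3) (135 / 8)).
      by apply: decays_piece => //; right.
    by apply: decays_le (decays_mul (decays_coord _ m) p7).
  apply: (@J_derive0 R L m (fun x => F m (x - c))) => //.
  - by move=> x; apply: (proj1 d0).
  - by have [_ [C hC]] := d0; exists C => x; rewrite -[rho x]expr1z; exact: hC.
  - move=> x /allP /(_ _ cL) /= xe; apply: dv_shift; exact: dF.
pose K : R := (8 * pi)^-1 * e ^+ 4.
have E x : blob (smooth_coef e) (x - c) =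
    K * (\sum_m D m (x - c)) + 6 * (8 * pi)^-1 / e ^+ 3 * (if sqn (x - c) < e ^+ 2 then 1 else 0).
  rewrite /blob /D sum3E /K /= /P /piece; set y := x - c.
  case: ifPn => [ye|_]; last by rewrite !mul0r !(mulr0, addr0).
  have sy : sqn y = e ^+ 2 * (tau e (sqn y) + 1) by rewrite /tau; field.
  have {}sy : y 0 o0 ^+ 2 + y 0 o1 ^+ 2 + y 0 o2 ^+ 2 = e ^+ 2 * (tau e (sqn y) + 1).
    by rewrite -sy /sqn sum3E.
  set t := tau e (sqn y) in sy *.
  have -> : y 0 o0 ^+ 2 = e ^+ 2 * (t + 1) - y 0 o1 ^+ 2 - y 0 o2 ^+ 2 by rewrite -sy; ring.
  by move: (pi : R) pi0 => p p0; field; rewrite p0 e1.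
have dS : decays L 6 (fun x => \sum_m D m (x - c)) by exact: decays_sum.
have dB : decays L 6 (fun x => if sqn (x - c) < e ^+ 2 then 1 else 0 : R).
  exact: decays_ball.
rewrite (J_ext (g := fun x => K * (\sum_m D m (x - c)) + 6 * (8 * pi)^-1 / e ^+ 3 *
  (if sqn (x - c) < e ^+ 2 then 1 else 0)) (fun x _ => E x)).
rewrite J_add; [|exact: decays_scale|exact: decays_scale].
rewrite !J_scale// J_sum// big1// mulr0 add0r J_ball.
by move: (pi : R) pi0 => p p0; field; rewrite p0 e1.
Qed.
Lemma decays_blob_shift : decays L 6 (fun x => blob (smooth_coef e) (x - c)).
Proof.
have h := decays_scale ((8 * pi)^-1) (decays_bump 6 0 (e ^+ 3 * (105 / 2)) (e ^+ 3 * (945 / 8))).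
apply: decays_ext h => x _; rewrite /blob /= /P /piece; congr (_ * _).
case: ifP => _; last by rewrite !mul0r.
rewrite (_ : 6 = 3 + 3)%N// exprD; field.
by rewrite gt_eqF.
Qed.

Lemma blob_bound x : `|blob (smooth_coef e) (x - c)| <=
  22 / (pi * e ^+ 3) * (if sqn (x - c) < e ^+ 2 then 1 else 0).
Proof.
have e3 : 0 < e ^+ 3 by rewrite exprn_gt0.
have pi0 := @pi_gt0 R.
rewrite /blob /= /piece; case: ifPn => [xe|_]; last by rewrite mul0r !mulr0 normr0.
have tb := tau_bound e0 (sqn_ge0 (x - c)) xe.
rewrite mulr1 normrM normrM gtr0_norm ?invr_gt0 ?mulr_gt0//.
rewrite normrX gtr0_norm ?invr_gt0// exprVn.
(* As [|tau| <= 1], the value is at most [105/2 + 945/8 < 176], and [176 / 8 = 22]. *)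
have h : `|0 + 105 / 2 * tau e (sqn (x - c)) + 945 / 8 * tau e (sqn (x - c)) ^+ 2| <= 176.
  have t2 : tau e (sqn (x - c)) ^+ 2 <= 1.
    by rewrite -[leLHS]real_normK ?num_real// exprn_ile1.
  have t0 := sqr_ge0 (tau e (sqn (x - c))).
  by move: tb; rewrite !ler_norml => /andP[? ?]; apply/andP; split; lra.
rewrite (_ : 22 / (pi * e ^+ 3) = (8 * pi)^-1 * ((e ^+ 3)^-1 * 176)); last first.
  by move: (pi : R) pi0 => p p0; field; rewrite !gt_eqF.
by rewrite !ler_pM2l ?invr_gt0// mulr_gt0.
Qed.

(** Unit mass reduces the claim to the integral of the blob against [g - g c]. By [blob_bound] and
    the volume of the ball, the L^1 norm of the blob is at most [22 * 4 / 3 = 88 / 3], which is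
    below 30 for every [e]. *)
Lemma J_blob_near (g : 'rV[R]_3 -> R) (d : R) :
  0 <= d -> decays L 0 g -> (forall x, sqn (x - c) < e ^+ 2 -> `|g x - g c| <= d) ->
  `|J L (fun x => blob (smooth_coef e) (x - c) * g x) - g c| <= 30 * d.
Proof.
move=> d0 dg gd; have dB := decays_blob_shift.
have dgc : decays L 0 (fun x => g x - g c).
  exact: decays_add dg (decays_cst L (- g c)).
have dBg : decays L 6 (fun x => blob (smooth_coef e) (x - c) * (g x - g c)).
  exact: (@decays_mul _ _ 6 0 _ _ dB dgc).
have -> : J L (fun x => blob (smooth_coef e) (x - c) * g x) - g c =
    J L (fun x => blob (smooth_coef e) (x - c) * (g x - g c)).
  rewrite (J_ext (g := fun x => blob (smooth_coef e) (x - c) * (g x - g c) +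
    g c * blob (smooth_coef e) (x - c))); last by move=> x _; ring.
  by rewrite J_add//; [rewrite J_scale// J_blob; ring|exact: decays_scale].
have dI := decays_scale (22 / (pi * e ^+ 3) * d) decays_ball.
apply: le_trans (J_abs_le dBg dI _) _ => [x _|].
  rewrite normrM mulrAC; have := blob_bound x; case: ifPn => [xe|_].
    by rewrite !mulr1 => h; apply: ler_pM => //; exact: gd.
  by rewrite !mulr0 normr_le0 => /eqP ->; rewrite normr0 mul0r mul0r.
rewrite J_scale ?J_ball; last exact: decays_ball.
have pi0 := @pi_gt0 R.
have -> : 22 / (pi * e ^+ 3) * d * (4 / 3 * pi * e ^+ 3) = 88 / 3 * d; last by lra.
by move: (pi : R) pi0 => p p0; field; rewrite !gt_eqF.
Qed.

End mass.
End ball_volume.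

(** * Interaction of two separated dipoles *)

Section interaction.
Context {R : realType}.
Notation vec := 'rV[R]_3.
Notation mat := 'M[R]_3.

Lemma off_sub (L L' : seq (vec * R)) x : {subset L <= L'} -> off L' x -> off L x.
Proof. by move=> LL' /allP h; apply/allP => c /LL'; exact: h. Qed.

Lemma decays_widen (L L' : seq (vec * R)) n f : {subset L <= L'} ->
  decays L n f -> decays L' n f.
Proof.
move=> LL' [cf [C fC]]; split=> [x /(off_sub LL')|]; first exact: cf.
by exists C => x /(off_sub LL'); exact: fC.
Qed.

(** Both sides equal the same [integral3], which does not refer to a list of spheres. *)
Lemma J_widen (L L' : seq (vec * R)) f : {subset L <= L'} ->
  decays L 6 f -> J L' f = J L f.
Proof.
move=> LL' df; have df' := decays_widen LL' df; apply: EFin_inj.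
rewrite -(integral_cut df) -(integral_cut df').
by rewrite -(integral3_cut (proj1 df) (fun x _ => erefl))
  -(integral3_cut (proj1 df') (fun x _ => erefl)).
Qed.

(** The integrand is the divergence of the field [F m], the sum over [k] of [w k * s k m], because
    the rows of [s] are divergence free. Continuity across all spheres, that is decay for the empty
    list, rules out surface terms; the orders [3 + 3] and [2 + 4] both give 6. *)
Lemma J_by_parts (L : seq (vec * R)) (w : 'I_3 -> vec -> R)
    (dw s ds : 'I_3 -> 'I_3 -> vec -> R) :
  (forall k, decays [::] 2 (w k)) -> (forall k m, decays [::] 3 (s k m)) ->
  (forall k m, decays L 3 (dw k m)) -> (forall k m, decays L 4 (ds k m)) ->
  (forall k m x, off L x -> is_derive x 'e_m (w k) (dw k m x)) ->
  (forall k m x, off L x -> is_derive x 'e_m (s k m) (ds k m x)) ->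
  (forall k x, off L x -> \sum_m ds k m x = 0) ->
  J L (fun x => \sum_k \sum_m dw k m x * s k m x) = 0.
Proof.
move=> hw hs hdw hds Dw Ds div0.
have sub0 : {subset [::] <= L} by [].
pose F m x := \sum_k w k x * s k m x.
pose D m x := \sum_k (dw k m x * s k m x + w k x * ds k m x).
have dF m : decays [::] 1 (F m).
  apply: decays_sum => k.
  by apply: decays_le (decays_mul (hw k) (hs k m)).
have dD m : decays L 6 (D m).
  apply: decays_sum => k; apply: decays_add.
    exact: decays_mul (hdw k m) (decays_widen sub0 (hs k m)).
  exact: decays_mul (decays_widen sub0 (hw k)) (hds k m).
have JD m : J L (D m) = 0.
  apply: (@J_derive0 R L m (F m)) => //.
  - by move=> x; apply: (proj1 (dF m)).
  - by have [_ [C hC]] := dF m; exists C => x; rewrite -[rho x]expr1z; exact: hC.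
  - move=> x ox; apply: dv_sum => k.
    by apply: dv_eq (dv_mul (Dw k m x ox) (Ds k m x ox)) _; ring.
rewrite (J_ext (g := fun x => \sum_m D m x)); last first.
  move=> x ox; rewrite /D [RHS]exchange_big; apply: eq_bigr => k _ /=.
  by rewrite big_split -mulr_sumr /= div0// mulr0 addr0.
by rewrite J_sum// big1.
Qed.

Lemma decays_shift0 (n : nat) (c : vec) (f : vec -> R) :
  decays [::] n f -> decays [::] n (fun x => f (x - c)).
Proof. exact: decays_shift. Qed.

Lemma sum_delta (k : 'I_3) (f : 'I_3 -> R) (p : R) :
  \sum_m f m * ((k == m)%:R * p) = f k * p.
Proof.
rewrite (bigD1 k)//= eqxx mul1r big1 ?addr0// => m mk.
by rewrite eq_sym (negbTE mk) mul0r mulr0.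
Qed.

Lemma piece_ext (e eta : R) k c0 c1 c2 g t : 0 < e -> e <= eta -> eta ^+ 2 <= t ->
  piece e k c0 c1 c2 g t = piece eta k c0 c1 c2 g t.
Proof.
move=> e0 ee et; rewrite /piece !ltNge et (le_trans _ et)//.
by apply: lerXn2r => //; rewrite nnegrE ltW// (lt_le_trans e0).
Qed.

Lemma gvel_smooth_ext (e eta : R) A x k m : 0 < e -> e <= eta -> eta ^+ 2 <= sqn x ->
  gvel (smooth_coef e) A x k m = gvel (smooth_coef eta) A x k m.
Proof. by move=> e0 ee xe; rewrite /gvel /= !(piece_ext _ _ _ _ _ e0 ee xe). Qed.

Section pair.
Variables (eta : R) (A B : mat) (u v : vec -> vec) (a b : vec).
Hypotheses (eta0 : 0 < eta) (trA : \tr A = 0) (trB : \tr B = 0).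
Hypotheses (ku : kinematic eta A u) (kv : kinematic eta B v).
Hypothesis sep : forall x, sqn (x - a) <= eta ^+ 2 -> eta ^+ 2 < sqn (x - b).

Let f x := ddot (grad u (x - a)) (grad v (x - b)).

Section scale.
Variable e : R.
Hypotheses (e0 : 0 < e) (ee : e <= eta).
Let L := [:: (a, eta ^+ 2); (b, eta ^+ 2); (a, e ^+ 2)].

Let offP x : off L x -> [/\ sqn (x - a) != eta ^+ 2, sqn (x - b) != eta ^+ 2 &
  sqn (x - a) != e ^+ 2].
Proof. by rewrite /off /= andbT => /and3P. Qed.

Let aL : (a, eta ^+ 2) \in L. Proof. by rewrite !inE eqxx. Qed.
Let bL : (b, eta ^+ 2) \in L. Proof. by rewrite !inE eqxx orbT. Qed.
Let eL : (a, e ^+ 2) \in L. Proof. by rewrite !inE eqxx !orbT. Qed.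

(** The stress tested is that of the extension at [b] of scale [eta], since it is continuous across
    the sphere where the stress of [v] may jump. In the ball at [a] it equals [grad v] minus a
    pressure, and the pressure meets the trace of [dw], which is zero; outside that ball [dw] itself
    vanishes. *)
Lemma J_replace : J L f = J L (fun x => \sum_k \sum_m
  gvel (smooth_coef e) A (x - a) k m * grad v (x - b) k m).
Proof.
pose dw k m x := grad u (x - a) k m - gvel (smooth_coef e) A (x - a) k m.
pose s k m x := stress (smooth_coef eta) B (x - b) k m.
have gu k m := decays_shift_sphere aL (decays_grad eta0 ku k m).
have gv k m := decays_shift_sphere bL (decays_grad eta0 kv k m).
have ge k m : decays L 3 (fun x => gvel (smooth_coef e) A (x - a) k m).
  apply: decays_widen (decays_shift0 a (decays_gvel e0 [::] A k m)) => //.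
have ddw k m : decays L 3 (dw k m) by exact: decays_sub.
have ds k m : decays [::] 3 (s k m).
  exact: (decays_shift0 b (decays_stress eta0 [::] B k m)).
have := @J_by_parts L (fun k x => u (x - a) 0 k - vel (smooth_coef e) A (x - a) k)
  dw s (fun k m x => dstress (smooth_coef eta) B (x - b) k m).
move=> H; have {}H : J L (fun x => \sum_k \sum_m dw k m x * s k m x) = 0.
  apply: H => //.
  - move=> k; apply: decays_sub.
      exact: (decays_shift0 a (decays_kinematic eta0 ku k)).
    exact: (decays_shift0 a (decays_vel e0 [::] A k)).
  - move=> k m; apply: (@decays_shift_sphere R 4 b _ L (fun y => dstress (smooth_coef eta) B y k m) bL).
    by apply: decays_dstress => //; rewrite inE eqxx.
  - move=> k m x /offP[xa xb xe]; apply: dv_sub.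
      exact: (dv_shift (dv_kinematic eta0 ku k m xa)).
    exact: (dv_shift (dv_vel (regular_smooth e0 xe) A k m)).
  - move=> k m x /offP[xa xb xe].
    exact: (dv_shift (dv_stress (regular_smooth eta0 xb) B k m)).
  - by move=> k x _; apply: div_dstress => //; apply: stokes_smooth => //; exact: sqn_ge0.
apply/eqP; rewrite -subr_eq0; apply/eqP; rewrite -[RHS]H.
rewrite -mulN1r -J_scale; last first.
  by apply: decays_sum => k; apply: decays_sum => m; exact: decays_mul (ge k m) (gv k m).
rewrite -J_add; last first.
- apply: decays_scale.
  by apply: decays_sum => k; apply: decays_sum => m; exact: decays_mul (ge k m) (gv k m).
- by apply: decays_sum => k; apply: decays_sum => m; exact: decays_mul (gu k m) (gv k m).
apply: J_ext => x /offP[xa xb xe].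
rewrite mulN1r /f /ddot -sumrB.
have [xs|xs] := leP (sqn (x - a)) (eta ^+ 2).
  have xs' := sep xs.
  have sE k m : s k m x = grad v (x - b) k m - (k == m)%:R * pre (smooth_coef eta) B (x - b).
    rewrite /s /stress -(grad_extE eta0 kv k m xs').
    rewrite (_ : blob _ _ = 0) ?mul0r ?addr0//.
    by rewrite /blob /= /piece ltNge (ltW xs') /= mul0r mulr0.
  have trw : \sum_k dw k k x = 0.
    rewrite /dw sumrB (tr_grad eta0 trA ku xa) div_gvel ?subrr//.
    by apply: stokes_smooth => //; exact: sqn_ge0.
  transitivity (\sum_k (\sum_m dw k m x * s k m x + dw k k x * pre (smooth_coef eta) B (x - b))).
    apply: eq_bigr => k _; rewrite -sumrB.
    rewrite -(sum_delta k (fun m => dw k m x)) -big_split.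
    by apply: eq_bigr => m _ /=; rewrite sE /dw; ring.
  by rewrite big_split /= -mulr_suml trw mul0r addr0.
apply: eq_bigr => k _; rewrite -sumrB; apply: eq_bigr => m _.
rewrite /dw (grad_extE eta0 ku k m xs) (gvel_smooth_ext _ _ _ e0 ee (ltW xs)).
by rewrite !subrr mul0r.
Qed.

(** The roles are exchanged: now the stress of the extension at [a] is tested with the merely
    continuous [v]. Its pressure meets the trace of [grad v], and the blob term is what survives. *)
Lemma J_gvel : J L (fun x => \sum_k \sum_m
    gvel (smooth_coef e) A (x - a) k m * grad v (x - b) k m) =
  - J L (fun x => blob (smooth_coef e) (x - a) * ddot A (grad v (x - b))).
Proof.
pose s k m x := stress (smooth_coef e) A (x - a) k m.
have gv k m := decays_shift_sphere bL (decays_grad eta0 kv k m).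
have ge k m : decays L 3 (fun x => gvel (smooth_coef e) A (x - a) k m).
  by apply: decays_widen (decays_shift0 a (decays_gvel e0 [::] A k m)).
have ds k m : decays [::] 3 (s k m).
  exact: (decays_shift0 a (decays_stress e0 [::] A k m)).
have := @J_by_parts L (fun k x => v (x - b) 0 k) (fun k m x => grad v (x - b) k m)
  s (fun k m x => dstress (smooth_coef e) A (x - a) k m).
move=> H; have {}H : J L (fun x => \sum_k \sum_m grad v (x - b) k m * s k m x) = 0.
  apply: H => //.
  - move=> k; exact: (decays_shift0 b (decays_kinematic eta0 kv k)).
  - move=> k m; apply: (@decays_shift_sphere R 4 a _ L (fun y => dstress (smooth_coef e) A y k m) eL).
    by apply: decays_dstress => //; rewrite inE eqxx.
  - move=> k m x /offP[xa xb xe].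
    exact: (dv_shift (dv_kinematic eta0 kv k m xb)).
  - move=> k m x /offP[xa xb xe].
    exact: (dv_shift (dv_stress (regular_smooth e0 xe) A k m)).
  - by move=> k x _; apply: div_dstress => //; apply: stokes_smooth => //; exact: sqn_ge0.
apply/eqP; rewrite -addr_eq0; apply/eqP; rewrite -[RHS]H.
rewrite -J_add; last first.
- have dA : decays L 3 (fun x => ddot A (grad v (x - b))).
    by apply: decays_sum => k; apply: decays_sum => m; exact: decays_scale (gv k m).
  have dB : decays L 3 (fun x => blob (smooth_coef e) (x - a)).
    by apply: decays_widen (decays_shift0 a (decays_blob e0 [::])).
  exact: decays_mul dB dA.
- by apply: decays_sum => k; apply: decays_sum => m; exact: decays_mul (ge k m) (gv k m).
apply: J_ext => x /offP[xa xb xe].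
transitivity (\sum_k (\sum_m grad v (x - b) k m * s k m x
    + grad v (x - b) k k * pre (smooth_coef e) A (x - a))).
  rewrite /ddot mulr_sumr -big_split; apply: eq_bigr => k _ /=.
  rewrite mulr_sumr -big_split /=.
  rewrite -(sum_delta k (fun m => grad v (x - b) k m)) -big_split.
  by apply: eq_bigr => m _ /=; rewrite /s /stress; ring.
by rewrite big_split /= -mulr_suml (tr_grad eta0 trB kv xb) mul0r addr0.
Qed.

End scale.

Lemma decays_pair : decays [:: (a, eta ^+ 2); (b, eta ^+ 2)] 6 f.
Proof.
apply: decays_sum => k; apply: decays_sum => m; apply: (@decays_mul _ _ 3 3).
  apply: (decays_shift_sphere _ (decays_grad eta0 ku k m)).
  by rewrite !inE eqxx.
apply: (decays_shift_sphere _ (decays_grad eta0 kv k m)).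
by rewrite !inE eqxx orbT.
Qed.

(** No limit is formed: neither side depends on [e], so it is enough to bound their difference by
    every [d > 0], with [e] chosen from the continuity of [g] at [a]. *)
Lemma J_pair : J [:: (a, eta ^+ 2); (b, eta ^+ 2)] f = - ddot A (hess_oseen (a - b) B).
Proof.
pose g x := ddot A (grad v (x - b)).
have ab : eta ^+ 2 < sqn (a - b).
  apply: sep; rewrite subrr /sqn sum3E !mxE expr0n !addr0; exact: sqr_ge0.
have ga : g a = ddot A (hess_oseen (a - b) B).
  apply: eq_bigr => i _; apply: eq_bigr => j _; congr (_ * _).
  by rewrite (hess_oseen_gvel eta0)// (grad_extE eta0 kv).
have dg : decays [:: (b, eta ^+ 2)] 3 g.
  apply: decays_sum => k; apply: decays_sum => m; apply: decays_scale.
  apply: (decays_shift_sphere _ (decays_grad eta0 kv k m)).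
  by rewrite !inE eqxx.
have cg : {for a, continuous g}.
  by apply: (proj1 dg); rewrite /off /= andbT gt_eqF.
rewrite -ga; apply/eqP; rewrite -addr_eq0; apply/eqP.
apply/eqP; rewrite -normr_le0; apply/ler_addgt0Pl => d d0; rewrite addr0.
have d30 : 0 < d / 30 by rewrite divr_gt0.
move: cg => /cvgrPdist_lt /(_ _ d30) /nbhs_ballP[r /= r0 hr].
pose e := Num.min eta r.
have e0 : 0 < e by rewrite lt_min eta0 r0.
have ee : e <= eta by rewrite ge_min lexx.
rewrite -(@J_widen _ [:: (a, eta ^+ 2); (b, eta ^+ 2); (a, e ^+ 2)] f _ decays_pair); last first.
  by move=> p; rewrite !inE => /orP[->|->]; rewrite ?orbT.
rewrite (J_replace e0 ee) (J_gvel e0) -normrN opprD opprK.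
rewrite (_ : d = 30 * (d / 30)); last by field.
apply: (@J_blob_near R e a _ e0 _ g).
- by rewrite !inE eqxx !orbT.
- exact: ltW.
- apply: (@decays_le _ _ 3 0) => //; apply: decays_widen dg => p.
  by rewrite !inE => ->; rewrite orbT.
(* Balls of row vectors refer to the sup norm; each coordinate of [x - a] is bounded by the
   Euclidean norm. *)
- move=> x xe; rewrite distrC ltW//; apply: hr; split=> // i j.
  rewrite ord1 /ball /= distrC; apply: lt_le_trans (_ : e <= r); last by rewrite ge_min lexx orbT.
  have := le_lt_trans (sqr_coord_le (x - a) j) xe.
  rewrite !mxE -[X in X < _]real_normK ?num_real// ltr_pXn2r ?nnegrE ?(ltW e0)//.
Qed.

End pair.
End interaction.

(** * Separation of the balls and expansion of the total energy *)

Section assembly.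
Context {R : realType}.
Notation vec := 'rV[R]_3.
Notation mat := 'M[R]_3.

Lemma reg_dipole_kinematic (eta : R) (A : mat) : 0 < eta -> \tr A = 0 ->
  kinematic eta A (reg_dipole eta A).
Proof.
move=> eta0 trA; have [u [p up]] := regularization_exists eta0 trA.
have [p' h] : [set u : vec -> vec | exists p, is_regularization eta A u p]
    (reg_dipole eta A) by apply: (getPex (P := [set u | exists p, is_regularization eta A u p])); exists u, p.
exact: (regularization_kinematic eta0 trA h).
Qed.

(** Young's inequality for the mixed term, with weights [s / r] and [r / s], for which the bound
    adds up to exactly [(r + s)^2]. *)
Lemma sqn_sub_le (x y : vec) (r s : R) : 0 < r -> 0 < s ->
  sqn x <= r ^+ 2 -> sqn y <= s ^+ 2 -> sqn (x - y) <= (r + s) ^+ 2.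
Proof.
move=> r0 s0 xr ys.
have E : sqn (x - y) <= (1 + s / r) * sqn x + (1 + r / s) * sqn y.
  rewrite /sqn !mulr_sumr -big_split /=; apply: ler_sum => i _; rewrite !mxE.
  rewrite -subr_ge0 (_ : _ - _ = r / s * (s / r * x 0 i + y 0 i) ^+ 2).
    by rewrite mulr_ge0 ?sqr_ge0// divr_ge0// ltW.
  by field; rewrite !gt_eqF.
rewrite (le_trans E)// (_ : (r + s) ^+ 2 = (1 + s / r) * r ^+ 2 + (1 + r / s) * s ^+ 2).
  by apply: lerD; rewrite ler_pM2l// addr_gt0// divr_gt0.
by field; rewrite !gt_eqF.
Qed.

(** Otherwise [a] and [b] would be at distance at most [2 eta]. *)
Lemma separated_balls (eta : R) (a b x : vec) : 0 < eta -> 4 * eta <= enorm (a - b) ->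
  sqn (x - a) <= eta ^+ 2 -> eta ^+ 2 < sqn (x - b).
Proof.
move=> eta0 h xa; rewrite ltNge; apply/negP => xb.
have := sqn_sub_le eta0 eta0 xb xa; rewrite opprB addrC addrA subrK.
apply/negP; rewrite -ltNge.
move: h; rewrite enormE => h.
have : (4 * eta) ^+ 2 <= sqn (a - b).
  rewrite -[leRHS](sqr_sqrtr (sqn_ge0 (a - b))).
  by rewrite ler_pXn2r ?nnegrE ?sqrtr_ge0// mulr_ge0// ltW.
by apply: lt_le_trans; have : 0 < eta ^+ 2 by [rewrite exprn_gt0]; lra.
Qed.

Section fields.
Variables (N : nat) (X xi : 'I_N -> vec) (eta : R).
Hypotheses (eta0 : 0 < eta).
Let L := [seq (X i, eta ^+ 2) | i <- enum 'I_N].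

Lemma mem_spheres i : (X i, eta ^+ 2) \in L.
Proof. by apply/mapP; exists i; rewrite ?mem_enum. Qed.

Section one.
Variable Psi : vec * vec -> mat.
Hypothesis trPsi : forall i, \tr (Psi (X i, xi i)) = 0.
Let u i := reg_dipole eta (Psi (X i, xi i)).
Let ku i : kinematic eta (Psi (X i, xi i)) (u i).
Proof. exact: reg_dipole_kinematic. Qed.

Lemma dv_hpart i x k m : off L x ->
  is_derive x 'e_m (fun y => hpart X xi eta Psi i y 0 k) (N%:R^-1 * grad (u i) (x - X i) k m).
Proof.
move=> /allP /(_ _ (mem_spheres i)) /= xi'.
rewrite (_ : (fun y => _) = fun y => N%:R^-1 * u i (y - X i) 0 k); last first.
  by apply/funext => y; rewrite /hpart mxE.
apply: dv_eq (dv_mul (dv_cst x 'e_m (N%:R^-1 : R))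
  (dv_shift (dv_kinematic eta0 (ku i) k m xi'))) _.
by cbv beta; ring.
Qed.

Lemma grad_hpart i x k m : off L x ->
  grad (hpart X xi eta Psi i) x k m = N%:R^-1 * grad (u i) (x - X i) k m.
Proof. by move=> ox; rewrite gradE; exact/pdE/dv_hpart. Qed.

Lemma grad_htotal x k m : off L x ->
  grad (htotal X xi eta Psi) x k m = \sum_i N%:R^-1 * grad (u i) (x - X i) k m.
Proof.
move=> ox; rewrite gradE; apply: pdE.
rewrite (_ : (fun y => _) = fun y => \sum_i hpart X xi eta Psi i y 0 k).
  by apply: dv_sum => i; exact: dv_hpart.
by apply/funext => y; rewrite /htotal summxE.
Qed.

End one.

Variables Psi1 Psi2 : vec * vec -> mat.
Hypothesis tr1 : forall i, \tr (Psi1 (X i, xi i)) = 0.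
Hypothesis tr2 : forall i, \tr (Psi2 (X i, xi i)) = 0.
Let u1 i := reg_dipole eta (Psi1 (X i, xi i)).
Let u2 i := reg_dipole eta (Psi2 (X i, xi i)).
Let G i j x := ddot (grad (u1 i) (x - X i)) (grad (u2 j) (x - X j)).

Lemma decays_cross i j : decays L 6 (G i j).
Proof.
have k1 := reg_dipole_kinematic eta0 (tr1 i); have k2 := reg_dipole_kinematic eta0 (tr2 j).
apply: decays_sum => k; apply: decays_sum => m; apply: (@decays_mul _ _ 3 3).
  exact: (decays_shift_sphere (mem_spheres i) (decays_grad eta0 k1 k m)).
exact: (decays_shift_sphere (mem_spheres j) (decays_grad eta0 k2 k m)).
Qed.

Lemma integral3_hpart i :
  integral3 (fun x => ddot (grad (hpart X xi eta Psi1 i) x) (grad (hpart X xi eta Psi2 i) x))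
  = ((N%:R ^+ 2)^-1 * J L (G i i))%:E.
Proof.
have d := decays_scale ((N%:R ^+ 2)^-1) (decays_cross i i).
rewrite (integral3_cut (proj1 d)); last first.
  move=> x ox; rewrite /G /ddot mulr_sumr; apply: eq_bigr => k _.
  rewrite mulr_sumr; apply: eq_bigr => m _.
  rewrite (grad_hpart tr1 i k m ox) (grad_hpart tr2 i k m ox) -exprVn.
  by rewrite /u1 /u2; ring.
by rewrite (integral_cut d) J_scale//; exact: decays_cross.
Qed.

Lemma integral3_htotal :
  integral3 (fun x => ddot (grad (htotal X xi eta Psi1) x) (grad (htotal X xi eta Psi2) x))
  = ((N%:R ^+ 2)^-1 * \sum_i \sum_j J L (G i j))%:E.
Proof.
have dS i : decays L 6 (fun x => \sum_j G i j x) by apply: decays_sum => j; exact: decays_cross.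
have dSS : decays L 6 (fun x => \sum_i \sum_j G i j x) by exact: decays_sum.
have d := decays_scale ((N%:R ^+ 2)^-1) dSS.
rewrite (integral3_cut (proj1 d)); last first.
  move=> x ox; rewrite /ddot.
  transitivity (\sum_k \sum_m \sum_i \sum_j (N%:R ^+ 2)^-1 *
      (grad (u1 i) (x - X i) k m * grad (u2 j) (x - X j) k m)).
    apply: eq_bigr => k _; apply: eq_bigr => m _.
    rewrite (grad_htotal tr1 k m ox) (grad_htotal tr2 k m ox) mulr_suml; apply: eq_bigr => i _.
    rewrite mulr_sumr; apply: eq_bigr => j _.
    by rewrite -exprVn /u1 /u2; ring.
  rewrite mulr_sumr.
  under eq_bigr do rewrite exchange_big.
  rewrite exchange_big; apply: eq_bigr => i _.
  rewrite mulr_sumr.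
  under eq_bigr do rewrite exchange_big.
  rewrite exchange_big; apply: eq_bigr => j _.
  by rewrite mulr_sumr; apply: eq_bigr => k _; rewrite mulr_sumr.
rewrite (integral_cut d) J_scale// J_sum//; congr (_ * _)%:E.
by apply: eq_bigr => i _; rewrite J_sum// => j; exact: decays_cross.
Qed.

Lemma J_cross i j : 4 * eta <= enorm (X i - X j) ->
  J L (G i j) = - ddot (Psi1 (X i, xi i)) (hess_oseen (X i - X j) (Psi2 (X j, xi j))).
Proof.
move=> sep; have k1 := reg_dipole_kinematic eta0 (tr1 i).
have k2 := reg_dipole_kinematic eta0 (tr2 j).
have S x : sqn (x - X i) <= eta ^+ 2 -> eta ^+ 2 < sqn (x - X j).
  exact: separated_balls.
rewrite -(J_pair eta0 (tr1 i) (tr2 j) k1 k2 S).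
have D := decays_pair (X i) (X j) eta0 k1 k2.
apply: J_widen D.
by move=> p; rewrite !inE => /orP[] /eqP ->; exact: mem_spheres.
Qed.

End fields.
End assembly.

Theorem theorem3p9 (R : realType) (c : R) (N : nat)
  (X xi : 'I_N -> 'rV[R]_3) (eta : R)
  (Psi1 Psi2 : 'rV[R]_3 * 'rV[R]_3 -> 'M[R]_3) :
  0 < c -> (0 < N)%N ->
  (forall i, sphere2 (xi i)) ->
  (forall i j, i != j -> c * N%:R `^ (- 3^-1) <= enorm (X i - X j)) ->
  0 < eta -> eta <= c / 4 * N%:R `^ (- 3^-1) ->
  continuous_tracefree Psi1 -> continuous_tracefree Psi2 ->
  ((N%:R ^+ 2)^-1 *
     \sum_i \sum_(j | j != i)
        ddot (Psi1 (X i, xi i)) (hess_oseen (X i - X j) (Psi2 (X j, xi j))))%:E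
  = (- integral3 (fun x => ddot (grad (htotal X xi eta Psi1) x)
                                (grad (htotal X xi eta Psi2) x))
     + \sum_i integral3 (fun x => ddot (grad (hpart X xi eta Psi1 i) x)
                                       (grad (hpart X xi eta Psi2 i) x)))%E.
Proof.
move=> c0 N0 hxi sep eta0 etac [_ T1] [_ T2].
have tr1 i : \tr (Psi1 (X i, xi i)) = 0 by exact: (T1 (X i, xi i) (hxi i)).
have tr2 i : \tr (Psi2 (X i, xi i)) = 0 by exact: (T2 (X i, xi i) (hxi i)).
rewrite (integral3_htotal eta0 tr1 tr2).
under [X in (_ + X)%E]eq_bigr do rewrite (integral3_hpart eta0 tr1 tr2).
rewrite sumEFin -EFinN -EFinD; congr (_%:E).
rewrite -mulr_sumr -mulrN -mulrDr; congr (_ * _).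
rewrite -sumrN -big_split; apply: eq_bigr => i _ /=.
(* The diagonal term of the double sum cancels the self-interaction integral. *)
rewrite [in RHS](bigD1 i)//= opprD addrAC addNr add0r -sumrN.
apply: eq_bigr => j ji.
(* The factor [c / 4] in the bound on [eta] is matched with the minimal distance of the centres. *)
have le_sep : 4 * eta <= enorm (X i - X j).
  by rewrite eq_sym in ji; apply: le_trans (sep _ _ ji); move: etac; lra.
by have := J_cross eta0 tr1 tr2 le_sep; cbv beta => ->; rewrite opprK.
Qed.
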